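(* Let $\alpha\in(0,1)$ and $\mathfrak r_1,\ldots,\mathfrak r_N\in[1,\infty)$ be fixed, let $\boldsymbol P\in\mathcal P_\psi$ be such that the generating distributions $\mathfrak m_1^{\boldsymbol P},\ldots,\mathfrak m_N^{\boldsymbol P}$ satisfy Assumption (FM), let $\boldsymbol\gamma=(\gamma_n)_{n=0}^{N-1}\in[0,1]^N$, and let $x_0\in\mathbb R_{\ge0}$. Then the following two assertions hold. (i) The map $\mathcal V_0^{x_0;\pi_{\boldsymbol\gamma}}:\mathcal P_\psi\to\mathbb R$ is `Fréchet differentiable' at $\boldsymbol P$ w.r.t. $(\mathbb M_{\text{Höl},\alpha},\psi)$ with `Fréchet derivative' $\dot{\mathcal V}_{0;\boldsymbol P}^{x_0;\pi_{\boldsymbol\gamma}}:\mathcal P_\psi^{\boldsymbol P;\pm}\to\mathbb R$ given by $$\dot{\mathcal V}_{0;\boldsymbol P}^{x_0;\pi_{\boldsymbol\gamma}}(\boldsymbol Q-\boldsymbol P)=\dot{\mathfrak v}_0^{\boldsymbol P,\boldsymbol Q;\pi_{\boldsymbol\gamma}}\,u_\alpha(x_0),\qquad \dot{\mathfrak v}_0^{\boldsymbol P,\boldsymbol Q;\pi_{\boldsymbol\gamma}}:=\sum_{k=0}^{N-1}v_{N-1}^{\boldsymbol P;\boldsymbol\gamma}\cdots(v_k^{\boldsymbol Q;\boldsymbol\gamma}-v_k^{\boldsymbol P;\boldsymbol\gamma})\cdots v_0^{\boldsymbol P;\boldsymbol\gamma}.$$ (ii) The map $\mathcal V_0^{x_0}:\mathcal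 P_\psi\to\mathbb R$ is `Hadamard differentiable' at $\boldsymbol P$ w.r.t. $(\mathbb M_{\text{Höl},\alpha},\psi)$ with `Hadamard derivative' $\dot{\mathcal V}_{0;\boldsymbol P}^{x_0}:\mathcal P_\psi^{\boldsymbol P;\pm}\to\mathbb R$ given by $$\dot{\mathcal V}_{0;\boldsymbol P}^{x_0}(\boldsymbol Q-\boldsymbol P)=\sup_{\pi\in\Pi_{\rm lin}(\boldsymbol P)}\dot{\mathcal V}_{0;\boldsymbol P}^{x_0;\pi}(\boldsymbol Q-\boldsymbol P)=\dot{\mathcal V}_{0;\boldsymbol P}^{x_0;\pi_{\boldsymbol\gamma^{\boldsymbol P}}}(\boldsymbol Q-\boldsymbol P).$$
   Context: **Model.** $N\in\mathbb N$; $\alpha\in(0,1)$; $u_\alpha(y):=y^\alpha$ for $y\in\mathbb R_{\ge0}:=[0,\infty)$; $\mathfrak r_1,\ldots,\mathfrak r_N\in[1,\infty)$ are fixed constants; $B_0:=1$, $B_{n+1}:=\mathfrak r_{n+1}B_n$. State space $E=\mathbb R_{\ge0}$ with Borel $\sigma$-algebra, action sets $A_n(x)=[0,x]$, $D_n=D:=\{(x,a)\in\mathbb R_{\ge0}^2:a\in[0,x]\}$. $\Pi$ is the set of all $\pi=(f_n)_{n=0}^{N-1}$ with $f_n:\mathbb R_{\ge0}\to\mathbb R_{\ge0}$ Borel measurable and $f_n(x)\in[0,x]$ for all $x$. Rewards: $r_n\equiv0$ for $n<N$ and $r_N(x):=u_\alpha(x/B_N)$. Put $\psi(x):=1+u_\alpha(x)$.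 $\mathcal P_\psi$ is the set of all $\boldsymbol P=(P_n)_{n=0}^{N-1}$ with probability kernels of the form $P_n((x,a),\cdot)=\mathfrak m_{n+1}\circ\eta_{n,(x,a)}^{-1}$, $(x,a)\in D_n$, where $\eta_{n,(x,a)}(y):=\mathfrak r_{n+1}x+a(y-\mathfrak r_{n+1})$ for $y\in\mathbb R_{\ge0}$, and $\mathfrak m_{n+1}$ is a Borel probability measure on $\mathbb R_{\ge0}$ with $\int u_\alpha\,d\mathfrak m_{n+1}<\infty$. The measures generating $\boldsymbol P$ are denoted $\mathfrak m_1^{\boldsymbol P},\ldots,\mathfrak m_N^{\boldsymbol P}$. Assumption (FM) for $\boldsymbol P$: for all $n=0,\ldots,N-1$, (a) $\int y^\alpha\,\mathfrak m_{n+1}^{\boldsymbol P}(dy)<\infty$, (b) $\mathfrak m_{n+1}^{\boldsymbol P}[\{0\}]=0$, (c) $\mathfrak m_{n+1}^{\boldsymbol P}[\{\mathfrak r_{n+1}\}]=0$. **Values.** Under $\mathbb P^{x_0,\boldsymbol P;\pi}$ the coordinate process $(X_0,\ldots,X_N)$ on $\mathbb R_{\ge0}^{N+1}$ is the Markov chain with $X_0=x_0$ and one-step transition probabilities $P_n((x,f_n(x)),\cdot)$ from time $n$ to $n+1$. Set $\mathcal V_0^{x_0;\pi}(\boldsymbol P):=\mathbb E^{x_0,\boldsymbol P;\pi}[r_N(X_N)]$ and $\mathcal V_0^{x_0}(\boldsymbol P):=\sup_{\pi\in\Pi}\mathcal V_0^{x_0;\pi}(\boldsymbol P)$. A strategy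 $\pi\in\Pi$ is optimal w.r.t. $\boldsymbol P$ if $\mathcal V_0^{x_0;\pi}(\boldsymbol P)=\mathcal V_0^{x_0}(\boldsymbol P)$ for all $x_0\in\mathbb R_{\ge0}$. **Linear strategies.** For $\boldsymbol\gamma=(\gamma_n)_{n=0}^{N-1}\in[0,1]^N$ let $\pi_{\boldsymbol\gamma}:=(f_n^{\boldsymbol\gamma})_{n=0}^{N-1}$ with $f_n^{\boldsymbol\gamma}(x):=\gamma_nx$; $\Pi_{\rm lin}$ is the set of all such $\pi_{\boldsymbol\gamma}$, and $\Pi_{\rm lin}(\boldsymbol P)$ is the set of those $\pi\in\Pi_{\rm lin}$ that are optimal w.r.t. $\boldsymbol P$. For $\gamma\in[0,1]$ let $$v_n^{\boldsymbol P;\gamma}:=\int_{\mathbb R_{\ge0}}u_\alpha\Big(1+\gamma\Big(\frac y{\mathfrak r_{n+1}}-1\Big)\Big)\,\mathfrak m_{n+1}^{\boldsymbol P}(dy),\qquad n=0,\ldots,N-1,$$ and $v_n^{\boldsymbol P;\boldsymbol\gamma}:=v_n^{\boldsymbol P;\gamma_n}$. Under (FM) there is a unique maximizer $\gamma_n^{\boldsymbol P}\in[0,1]$ of $\gamma\mapsto v_n^{\boldsymbol P;\gamma}$ over $[0,1]$; $\boldsymbol\gamma^{\boldsymbol P}:=(\gamma_n^{\boldsymbol P})_{n=0}^{N-1}$. In the sum defining $\dot{\mathfrak v}_0^{\boldsymbol P,\boldsymbol Q;\pi_{\boldsymbol\gamma}}$, the $k$-th summand is $(v_k^{\boldsymbol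 Q;\boldsymbol\gamma}-v_k^{\boldsymbol P;\boldsymbol\gamma})\prod_{0\le j\le N-1,\,j\ne k}v_j^{\boldsymbol P;\boldsymbol\gamma}$. **Metric and differentiability.** $\mathbb M_{\text{Höl},\alpha}$ is the set of all $h:\mathbb R_{\ge0}\to\mathbb R$ with $|h(x)-h(y)|\le|x-y|^\alpha$ for all $x,y$. For $\boldsymbol P,\boldsymbol Q\in\mathcal P_\psi$, $$d(\boldsymbol P,\boldsymbol Q):=\max_{n=0,\ldots,N-1}\ \sup_{(x,a)\in D_n}\frac1{\psi(x)}\ \sup_{h\in\mathbb M_{\text{Höl},\alpha}}\Big|\int h(y)\,P_n((x,a),dy)-\int h(y)\,Q_n((x,a),dy)\Big|.$$ $\mathcal P_\psi^{\boldsymbol P;\pm}:=\{\boldsymbol Q-\boldsymbol P:\boldsymbol Q\in\mathcal P_\psi\}$. A map $\mathcal V:\mathcal P_\psi\to\mathbb R$ is `Fréchet differentiable' (resp. `Hadamard differentiable') at $\boldsymbol P$ w.r.t. $(\mathbb M_{\text{Höl},\alpha},\psi)$ with `derivative' $\dot{\mathcal V}_{\boldsymbol P}:\mathcal P_\psi^{\boldsymbol P;\pm}\to\mathbb R$ if $\boldsymbol Q\mapsto\dot{\mathcal V}_{\boldsymbol P}(\boldsymbol Q-\boldsymbol P)$ is continuous on $(\mathcal P_\psi,d)$ and $$\lim_{m\to\infty}\Big|\frac{\mathcal V(\boldsymbol P+\varepsilon_m(\boldsymbol Q-\boldsymbol P))-\mathcal V(\boldsymbol P)}{\varepsilon_m}-\dot{\mathcal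 V}_{\boldsymbol P}(\boldsymbol Q-\boldsymbol P)\Big|=0\quad\text{uniformly in }\boldsymbol Q\in\mathcal K$$ for every sequence $(\varepsilon_m)$ in $(0,1]$ with $\varepsilon_m\to0$ and every $\mathcal K\subseteq\mathcal P_\psi$ that is bounded (there are $\boldsymbol P'\in\mathcal P_\psi$, $\delta>0$ with $d(\boldsymbol Q,\boldsymbol P')\le\delta$ for all $\boldsymbol Q\in\mathcal K$) (resp. relatively compact: every sequence in $\mathcal K$ has a subsequence $d$-converging to some element of $\mathcal P_\psi$). *)

(* Defs.v *)
From HB Require Import structures.
From mathcomp Require Import all_boot all_order all_algebra.
From mathcomp Require Import all_classical all_reals all_analysis.
From mathcomp Require Import measurable_realfun.

Set Implicit Arguments.
Unset Strict Implicit.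
Unset Printing Implicit Defensive.

Import Order.TTheory GRing.Theory Num.Theory.
Import numFieldNormedType.Exports.

Local Open Scope classical_set_scope.
Local Open Scope ring_scope.

(* The state space [0, +oo[ is encoded in R: measures live on the Borel sets
   of R and give mass 0 to the negative half-line, functions of a state are
   functions on R whose values at negative arguments are irrelevant. *)

Section kernels.
Context d0 d1 d2 (T0 : measurableType d0) (T1 : measurableType d1)
  (T2 : measurableType d2) (R : realType).

(* x |-> k (f x) *)
Definition kpull (k : R.-pker T1 ~> T2) (f : T0 -> T1)
  (mf : measurable_fun setT f) (x : T0) : {measure set T2 -> \bar R} := k (f x).

Section kpull.
Variables (k : R.-pker T1 ~> T2) (f : T0 -> T1) (mf : measurable_fun setT f).

Let measurable_kpull U : measurable U ->
  measurable_fun [set: T0] (kpull k mf ^~ U).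
Proof.
by move=> mU; have := measurable_kernel k U mU; move/measurableT_comp; apply.
Qed.

HB.instance Definition _ := isKernel.Build _ _ _ _ _ (kpull k mf)
  measurable_kpull.

Let kpull_prob x : kpull k mf x [set: T2] = 1%E.
Proof. exact: prob_kernel. Qed.

HB.instance Definition _ := Kernel_isProbability.Build _ _ _ _ _ (kpull k mf)
  kpull_prob.
End kpull.

Definition pkproduct (k1 : R.-pker T0 ~> T1) (k2 : R.-pker (T0 * T1) ~> T2) :
  T0 -> {measure set (T1 * T2) -> \bar R} := mkproduct k1 k2.

Section pkproduct.
Variables (k1 : R.-pker T0 ~> T1) (k2 : R.-pker (T0 * T1) ~> T2).

HB.instance Definition _ := isKernel.Build _ _ _ _ _ (pkproduct k1 k2)
  (measurable_kproduct k1 k2).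

Let pkproduct_prob x : pkproduct k1 k2 x setT = 1%E.
Proof.
rewrite /pkproduct /mkproduct /= /kproduct.
rewrite (eq_integral (cst 1%E)) => [|y _].
  by rewrite integral_cst// mul1e prob_kernel.
rewrite /kernel.intker_indic (eq_integral (cst 1%E)) => [|z _].
  by rewrite integral_cst// mul1e prob_kernel.
by rewrite indicT.
Qed.

HB.instance Definition _ := Kernel_isProbability.Build _ _ _ _ _
  (pkproduct k1 k2) pkproduct_prob.
End pkproduct.
End kernels.

Section convex_combination.
Context d (T : measurableType d) (R : realType).

Definition mconv (t : {i01 R}) (p q : probability T R) : set T -> \bar R :=
  measure_add (mscale (1 - t%:num)%:nng p) (mscale t%:num%:nng q).

Variables (t : {i01 R}) (p q : probability T R).

HB.instance Definition _ := Measure.on (mconv t p q).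

Lemma mconvE A : mconv t p q A = ((1 - t%:num)%:E * p A + t%:num%:E * q A)%E.
Proof. by rewrite /mconv measure_addE. Qed.

Let mconv_setT : mconv t p q setT = 1%E.
Proof. by rewrite mconvE !probability_setT !mule1 -EFinD subrK. Qed.

HB.instance Definition _ :=
  @Measure_isProbability.Build _ _ R (mconv t p q) mconv_setT.

Lemma integral_mconv (D : set T) (f : T -> \bar R) : measurable D ->
  measurable_fun D f -> (forall x, D x -> 0 <= f x)%E ->
  (\int[mconv t p q]_(x in D) f x =
   (1 - t%:num)%:E * \int[p]_(x in D) f x + t%:num%:E * \int[q]_(x in D) f x)%E.
Proof.
move=> mD mf f0; rewrite /mconv ge0_integral_measure_add//.
by rewrite !ge0_integral_mscale.
Qed.
End convex_combination.

Section wealth_step.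
Context {R : realType}.
Implicit Types (s : R) (xa : R * R) (m : probability R R).

Definition eta s xa (y : R) : R := s * xa.1 + xa.2 * (y - s).

Lemma measurable_eta s :
  measurable_fun setT (fun z : (R * R) * R => eta s z.1 z.2).
Proof.
by apply: measurable_funD; apply: measurable_funM => //;
  [exact: measurableT_comp|exact: measurableT_comp|exact: measurable_funB].
Qed.

Let measurable_eta2 s xa : measurable_fun setT (eta s xa).
Proof. by apply: measurable_funD => //; apply: measurable_funM => //;
  exact: measurable_funB. Qed.

Definition step_measure m s xa : set R -> \bar R := pushforward m (eta s xa).

Section step_kernel.
Variables (m : probability R R) (s : R).

Section measure.
Variable xa : R * R.

Let step0 : step_measure m s xa set0 = 0%E.
Proof. by rewrite /step_measure /pushforward preimage_set0 measure0. Qed.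

Let step_ge0 U : (0 <= step_measure m s xa U)%E.
Proof. exact: measure_ge0. Qed.

Let step_sigma_additive : semi_sigma_additive (step_measure m s xa).
Proof.
have mf := @measurable_eta2 s xa.
exact: (@measure_semi_sigma_additive _ _ _ (pushforward m (eta s xa))).
Qed.

HB.instance Definition _ := isMeasure.Build _ _ _ (step_measure m s xa)
  step0 step_ge0 step_sigma_additive.
End measure.

Definition step_kernel (xa : R * R) : {measure set R -> \bar R} :=
  step_measure m s xa.

Let measurable_step U : measurable U -> measurable_fun setT (step_kernel ^~ U).
Proof.
move=> mU; pose A := (fun z : (R * R) * R => eta s z.1 z.2) @^-1` U.
have mA : measurable A by rewrite -[A]setTI; exact: measurable_eta.
rewrite (_ : _ ^~ U = m \o xsection A); last first.
  by apply/funext => xa /=; rewrite xsectionE.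
exact: measurable_fun_xsection.
Qed.

HB.instance Definition _ := isKernel.Build _ _ _ _ _ step_kernel measurable_step.

Let step_prob xa : step_kernel xa setT = 1%E.
Proof. exact: probability_setT. Qed.

HB.instance Definition _ := Kernel_isProbability.Build _ _ _ _ _ step_kernel
  step_prob.
End step_kernel.
End wealth_step.

(* pathT R n is R^{n+1}, as an iterated product with its product
   sigma-algebra; path_end is the coordinate of index n. *)
Fixpoint path_display (n : nat) : measure_display :=
  if n is k.+1 then measure_prod_display (path_display k, default_measure_display)
  else default_measure_display.

Fixpoint pathT (R : realType) (n : nat) : measurableType (path_display n) :=
  match n with
  | 0 => R : measurableType _
  | k.+1 => (pathT R k * R)%type : measurableType _
  end.

Definition path_end (R : realType) (n : nat) : pathT R n -> R :=
  match n with 0 => idfun | _.+1 => snd end.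

Lemma measurable_path_end (R : realType) (n : nat) :
  measurable_fun setT (@path_end R n).
Proof. by case: n => [|n] /=; [exact: measurable_id|exact: measurable_snd]. Qed.

Section model.
Context (R : realType) (alpha : R) (N : nat) (r : 'I_N -> R).
(* r n is the constant of index n+1, for the period from n to n+1; likewise
   gen P n below is the measure of index n+1. *)

Local Notation Rge0 := (`[0, +oo[%classic : set R).

Definition u (y : R) : R := y `^ alpha.
Definition psi (x : R) : R := 1 + u x.
Definition D : set (R * R) := [set xa | 0 <= xa.2 <= xa.1].
(* B_N *)
Definition bond : R := \prod_(n < N) r n.

(* An element P of P_psi is stored through its generating measures; its
   transition kernels are ker P, and ker_inj below shows that the kernels on D
   determine the measures. *)
Record Ppsi := {
  gen : 'I_N -> probability R R;
  gen_ge0 : forall n, gen n `]-oo, 0[%classic = 0%E;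
  gen_int : forall n, (\int[gen n]_(y in Rge0) (u y)%:E < +oo)%E }.

(* Only the values of ker P n on D matter. *)
Definition ker (P : Ppsi) (n : 'I_N) : R.-pker (R * R)%type ~> R :=
  step_kernel (gen P n) (r n).

Lemma ker_inj (P Q : Ppsi) :
  (forall n xa U, D xa -> measurable U -> ker P n xa U = ker Q n xa U) ->
  forall n U, measurable U -> gen P n U = gen Q n U.
Proof.
move=> PQ n U mU; have D11 : D (1, 1) by rewrite /D /= ler01 lexx.
have := PQ n (1, 1) U D11 mU; rewrite /= /step_measure /pushforward.
rewrite (_ : eta (r n) (1, 1) @^-1` U = U)//.
by apply/funext => y; rewrite /eta /= mulr1 mul1r addrC subrK.
Qed.

Section mix.
Variables (t : {i01 R}) (P Q : Ppsi).

Let mix_gen (n : 'I_N) : probability R R := mconv t (gen P n) (gen Q n).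

Let mix_ge0 n : mix_gen n `]-oo, 0[%classic = 0%E.
Proof. by rewrite /= mconvE !gen_ge0 !mule0 adde0. Qed.

Let mix_int n : (\int[mix_gen n]_(y in Rge0) (u y)%:E < +oo)%E.
Proof.
rewrite integral_mconv//.
- by rewrite lte_add_pinfty// lte_mul_pinfty ?lee_fin ?gen_int// subr_ge0.
- apply/measurable_EFinP/measurable_funTS; exact: measurable_powR.
- by move=> y _; rewrite lee_fin powR_ge0.
Qed.

(* P + t (Q - P) *)
Definition mix : Ppsi :=
  {| gen := mix_gen; gen_ge0 := mix_ge0; gen_int := mix_int |}.

Lemma ker_mix n xa U : measurable U ->
  ker mix n xa U =
  (ker P n xa U + t%:num%:E * (ker Q n xa U - ker P n xa U))%E.
Proof.
move=> mU; rewrite [LHS]mconvE.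
have fk (S : Ppsi) : ker S n xa U \is a fin_num.
  exact: finite_kernel_measure.
rewrite -[gen P n _]/(ker P n xa U) -[gen Q n _]/(ker Q n xa U).
move: (fk P) (fk Q); case: (ker P n xa U) => [p| |]//.
case: (ker Q n xa U) => [q| |]// _ _.
congr (_%:E) => /=.
by rewrite mulrBl mul1r mulrBr addrA addrAC.
Qed.
End mix.

Definition FM (P : Ppsi) := forall n : 'I_N,
  [/\ (\int[gen P n]_(y in Rge0) (u y)%:E < +oo)%E,
      gen P n [set 0] = 0%E & gen P n [set r n] = 0%E].

Record strategy := {
  act : 'I_N -> R -> R;
  measurable_act : forall n, measurable_fun setT (act n);
  act_admissible : forall n x, 0 <= x -> 0 <= act n x <= x }.

Section linear_strategy.
Variable gamma : 'I_N -> {i01 R}.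

Let lin_act (n : 'I_N) (x : R) := (gamma n)%:num * x.

Let measurable_lin n : measurable_fun setT (lin_act n).
Proof. exact: measurable_funM. Qed.

Let lin_admissible n x : 0 <= x -> 0 <= lin_act n x <= x.
Proof. by move=> x0; rewrite /lin_act mulr_ge0//= ler_piMl. Qed.

Definition lin : strategy := {| act := lin_act;
  measurable_act := measurable_lin; act_admissible := lin_admissible |}.
End linear_strategy.

Lemma measurable_state_act (pi : strategy) n :
  measurable_fun setT (fun x : R => (x, act pi n x)).
Proof. by apply: measurable_fun_pair => //; exact: measurable_act. Qed.

(* x |-> P_n((x, f_n(x)), .) *)
Definition transition (P : Ppsi) (pi : strategy) (n : 'I_N) : R.-pker R ~> R :=
  kpull (ker P n) (measurable_state_act pi n).

(* path_law P pi n _ x0 is the law of (X_0, ..., X_n) under P^{x0,P;pi}. *)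
Fixpoint path_law (P : Ppsi) (pi : strategy) (n : nat) :
    (n <= N)%N -> R.-pker R ~> pathT R n :=
  match n return (n <= N)%N -> R.-pker R ~> pathT R n with
  | 0 => fun _ => kdirac (@measurable_id _ R setT) : R.-pker R ~> R
  | k.+1 => fun kN => pkproduct (path_law P pi (ltnW kN))
      (kpull (transition P pi (Ordinal kN))
        (measurableT_comp (@measurable_path_end R k) measurable_snd))
  end.

(* the expectation of r_N(X_N) under P^{x0,P;pi} *)
Definition policy_value (x0 : R) (pi : strategy) (P : Ppsi) : \bar R :=
  (\int[path_law P pi (leqnn N) x0]_w (u (path_end w / bond))%:E)%E.

Definition value (x0 : R) (P : Ppsi) : \bar R :=
  ereal_sup [set policy_value x0 pi P | pi in [set: strategy]].

Definition optimal (P : Ppsi) (pi : strategy) :=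
  forall x0, 0 <= x0 -> policy_value x0 pi P = value x0 P.

Definition v (P : Ppsi) (n : 'I_N) (g : {i01 R}) : R :=
  \int[gen P n]_(y in Rge0) u (1 + g%:num * (y / r n - 1)).

(* gamma^P: under (FM) the set below is a singleton *)
Definition gamma_opt (P : Ppsi) (n : 'I_N) : {i01 R} :=
  xget 0%:i01 [set g | forall g', v P n g' <= v P n g].

Definition vdot (P Q : Ppsi) (gamma : 'I_N -> {i01 R}) : R :=
  \sum_(k < N) (v Q k (gamma k) - v P k (gamma k)) *
    \prod_(j < N | j != k) v P j (gamma j).

Definition Hol : set (R -> R) :=
  [set h | forall x y, 0 <= x -> 0 <= y -> `|h x - h y| <= `|x - y| `^ alpha].

Definition dist (P Q : Ppsi) : \bar R :=
  \big[maxe/0%E]_(n < N)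
    ereal_sup [set ((psi xa.1)^-1%:E *
      ereal_sup [set `| \int[ker P n xa]_(y in Rge0) h y -
                        \int[ker Q n xa]_(y in Rge0) h y |%:E | h in Hol])%E
    | xa in D].

(* Q - P, as a family of real-valued set functions indexed by D *)
Definition diff_ker (Q P : Ppsi) : 'I_N -> R * R -> set R -> R :=
  fun n xa U => if `[< D xa /\ measurable U >]
    then fine (ker Q n xa U) - fine (ker P n xa U) else 0.

Definition dist_continuous (f : Ppsi -> R) :=
  forall Q e, 0 < e -> exists2 delta, 0 < delta &
    forall Q', (dist Q' Q < delta%:E)%E -> `|f Q' - f Q| < e.

Definition bounded_family (K : set Ppsi) :=
  exists (P' : Ppsi) (delta : R), 0 < delta /\
    forall Q, K Q -> (dist Q P' <= delta%:E)%E.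

Definition relatively_compact (K : set Ppsi) :=
  forall Qs : nat -> Ppsi, (forall k, K (Qs k)) ->
  exists (phi : nat -> nat) (Q : Ppsi), {homo phi : i j / (i < j)%N} /\
    (fun k => dist (Qs (phi k)) Q) @ \oo --> 0%E.

(* The derivative dV is only used at differences Q - P. *)
Definition differentiable_along (S : set (set Ppsi)) (V : Ppsi -> R)
    (P : Ppsi) (dV : ('I_N -> R * R -> set R -> R) -> R) :=
  dist_continuous (fun Q => dV (diff_ker Q P)) /\
  forall K, S K -> forall eps : nat -> {i01 R},
    (forall m, 0 < (eps m)%:num) -> (fun m => (eps m)%:num) @ \oo --> (0 : R) ->
    forall e, 0 < e -> \forall m \near \oo, forall Q, K Q ->
      `| (V (mix (eps m) P Q) - V P) / (eps m)%:num - dV (diff_ker Q P) | < e.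

Definition Frechet_differentiable := differentiable_along bounded_family.
Definition Hadamard_differentiable := differentiable_along relatively_compact.

End model.

(* Main.v *)
(* The wealth dynamics and the power utility are homogeneous, so the value of
   [lin gamma] is the product of the growth factors [v P n (gamma n)] times
   [u x0], and the value is the product of their maxima over the fraction
   invested, times [u x0].  A growth factor is affine in [P], and it is the
   integral of an alpha-Hoelder function against the kernel at [(1, 1)], hence
   Lipschitz for [dist].  This gives (i) by expanding the product to first order.
   For (ii), strict concavity makes the maximizing fraction unique; since
   [v Q n] is Hoelder in the fraction with a constant controlled by its value at
   fraction 1, Danskin's argument differentiates each maximum uniformly over any
   family on which these constants are bounded. *)

Require Import Defs.
From mathcomp Require Import all_boot all_order all_algebra.
From mathcomp Require Import all_classical all_reals all_analysis.
From mathcomp Require Import measurable_realfun.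
From mathcomp Require Import ring lra.

Set Implicit Arguments.
Unset Strict Implicit.
Unset Printing Implicit Defensive.

Import Order.TTheory GRing.Theory Num.Theory.
Import numFieldNormedType.Exports.

Local Open Scope classical_set_scope.
Local Open Scope ring_scope.

(** * Concavity and Hoelder estimates for the power function *)

Section power_inequalities.
Context {R : realType} (a : R).
Hypothesis a01 : 0 < a < 1.

Let a_gt0 : 0 < a. Proof. by case/andP: a01. Qed.
Let a_lt1 : a < 1. Proof. by case/andP: a01. Qed.

(* With [L = a ln x], add [exp (L / a - L) > 1 + L / a - L] with weight [a] and
   [exp (- L) > 1 - L] with weight [1 - a], then multiply by [exp L]. *)
Lemma powR_lt_tangent1 (x : R) : 0 <= x -> x != 1 -> x `^ a < 1 - a + a * x.
Proof.
rewrite le_eqVlt => /predU1P[<- _|x0 x1].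
  by rewrite powR0 ?gt_eqF// mulr0 addr0 subr_gt0.
have lnx0 : ln x != 0 by rewrite ln_eq0.
pose L := a * ln x.
have xE : x = expR L * expR (ln x - L) by rewrite -expRD addrC subrK lnK.
have xaE : x `^ a = expR L by rewrite /powR gt_eqF.
have H1 : 1 + (ln x - L) < expR (ln x - L).
  apply: expR_gt1Dx; rewrite /L -{1}[ln x]mul1r -mulrBl mulf_neq0//.
  by rewrite subr_eq0 gt_eqF.
have H2 : 1 - L < expR (- L) by rewrite expR_gt1Dx// oppr_eq0 mulf_neq0// gt_eqF.
have H3 : expR L * expR (- L) = 1 by rewrite -expRD subrr expR0.
have : expR L * 1 < expR L * ((1 - a) * expR (- L) + a * expR (ln x - L)).
  rewrite ltr_pM2l ?expR_gt0//.
  have LE : L = a * ln x by [].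
  have a1 : 0 < 1 - a by rewrite subr_gt0.
  have H4 : (1 - a) * (1 - L) < (1 - a) * expR (- L) by rewrite (ltr_pM2l a1).
  have H5 : a * (1 + (ln x - L)) < a * expR (ln x - L) by rewrite (ltr_pM2l a_gt0).
  have H6 : (1 - a) * (1 - L) + a * (1 + (ln x - L)) = 1 by rewrite LE; ring.
  lra.
rewrite xaE mulr1 mulrDr (mulrCA _ (1 - a)) H3 mulr1 (mulrCA _ a).
by rewrite -xE.
Qed.

(** After division by the midpoint [s], the tangent bound applies to [x / s] and [y / s]; these add
    up to 2, and so do the two bounds. *)
Lemma powR_midpoint_lt (x y : R) : 0 <= x -> 0 <= y -> x != y ->
  (x `^ a + y `^ a) / 2 < ((x + y) / 2) `^ a.
Proof.
move=> x0 y0 xy; set s := (x + y) / 2.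
have s0 : 0 < s.
  rewrite lt_neqAle divr_ge0 ?addr_ge0// andbT eq_sym.
  rewrite mulf_neq0 ?invr_eq0 ?pnatr_eq0//.
  rewrite paddr_eq0//; apply/negP => /andP[/eqP xx /eqP yy].
  by rewrite xx yy eqxx in xy.
have scale z : 0 <= z -> z `^ a = s `^ a * (z / s) `^ a.
  move=> z0; have zs0 : 0 <= z / s by rewrite divr_ge0// ltW.
    by rewrite -(powRM _ (ltW s0) zs0) mulrC divfK// gt_eqF.
have ne z w : s = (z + w) / 2 -> z != w -> z / s != 1.
  move=> sE zw; apply/eqP => zs1; have zs : z = s by rewrite -(divfK (lt0r_neq0 s0) z) zs1 mul1r.
  by case/eqP: zw; lra.
have := powR_lt_tangent1 (divr_ge0 x0 (ltW s0)) (ne x y erefl xy).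
have sE' : s = (y + x) / 2 by rewrite /s addrC.
rewrite eq_sym in xy.
have := powR_lt_tangent1 (divr_ge0 y0 (ltW s0)) (ne y x sE' xy).
rewrite (scale x)// (scale y)//.
have sa0 : 0 < s `^ a by exact: powR_gt0.
move=> Hy Hx.
have xys : x / s + y / s = 2 by rewrite -mulrDl -[x + y](@divfK _ 2)// mulrAC divff ?mul1r// gt_eqF.
have : s `^ a * ((x / s) `^ a + (y / s) `^ a) < s `^ a * 2.
  rewrite ltr_pM2l//; have : a * (x / s) + a * (y / s) = a * 2 by rewrite -mulrDr xys.
  lra.
lra.
Qed.

(** Each share [z / (x + y)] lies in [0, 1], where the power dominates the identity, and the two
    shares sum to 1. *)
Lemma powRD_le (x y : R) : 0 <= x -> 0 <= y ->
  (x + y) `^ a <= x `^ a + y `^ a.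
Proof.
move=> x0 y0; have [s0|] := ltP 0 (x + y); last first.
  rewrite le_eqVlt ltNge addr_ge0//= orbF => /eqP ->.
  by rewrite powR0 ?gt_eqF// addr_ge0 ?powR_ge0.
have part z : 0 <= z -> z <= x + y -> z / (x + y) * (x + y) `^ a <= z `^ a.
  rewrite le_eqVlt => /predU1P[<- _|z0 zs].
    by rewrite !mul0r powR_ge0.
  have zs0 : 0 < z / (x + y) by rewrite divr_gt0.
  rewrite -{2}[z](divfK (lt0r_neq0 s0)) (powRM _ (ltW zs0) (ltW s0)).
  rewrite ler_wpM2r ?powR_ge0// ger1_powR ?(ltW a_lt1)//.
  by rewrite zs0 ler_pdivrMr// mul1r.
have := lerD (part x x0 _) (part y y0 _).
rewrite -mulrDl -mulrDl divff ?gt_eqF// mul1r; apply; lra.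
Qed.

Lemma powR_holder (x y : R) : 0 <= x -> 0 <= y ->
  `|x `^ a - y `^ a| <= `|x - y| `^ a.
Proof.
wlog xy : x y / y <= x => [hw x0 y0|x0 y0].
  have [/hw/(_ x0 y0)//|/ltW/hw] := leP y x.
  by move=> /(_ y0 x0); rewrite distrC (distrC y).
rewrite !ger0_norm ?subr_ge0//; last first.
  by rewrite ge0_ler_powR// ?nnegrE// ltW.
rewrite lerBlDr -{1}[x](subrK y) powRD_le// subr_ge0//.
Qed.

Lemma powR_norm_holder (x y : R) :
  `| `|x| `^ a - `|y| `^ a | <= `|x - y| `^ a.
Proof.
rewrite (le_trans (powR_holder _ _))// ge0_ler_powR ?nnegrE// ?(ltW a_gt0)//.
exact: ler_dist_dist.
Qed.

End power_inequalities.

(** Full investment: the growth factor there is the [alpha]-moment of [y / r n], which controls the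
    growth factors at all fractions. *)
Definition one01 (R : realType) : {i01 R} := Itv01 ler01 (lexx 1).

(** * One-period growth factors and their unique maximizers *)

Section growth_factor.
Context {R : realType} (alpha : R) (N : nat) (r : 'I_N -> R).
Hypothesis halpha : 0 < alpha < 1.
Hypothesis hr : forall n, 1 <= r n.
Implicit Types (P : Ppsi alpha N) (n : 'I_N) (g : {i01 R}) (x y : R).

Local Notation Rge0 := (`[0, +oo[%classic : set R).
Local Notation u := (u alpha).

Let alpha_gt0 : 0 < alpha. Proof. by case/andP: halpha. Qed.
Let r_gt0 n : 0 < r n. Proof. exact: lt_le_trans (hr n). Qed.

Lemma Rge0P y : Rge0 y <-> 0 <= y.
Proof. by rewrite /= in_itv/= andbT. Qed.

Lemma gen_Rge0 P n : gen P n Rge0 = 1%E.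
Proof.
by rewrite -setCitvl probability_setC// gen_ge0 sube0.
Qed.

Lemma ge0_integral_gen P n (f : R -> \bar R) : measurable_fun setT f ->
  (forall y, 0 <= f y)%E ->
  (\int[gen P n]_y f y = \int[gen P n]_(y in Rge0) f y)%E.
Proof.
move=> mf f0; rewrite (ge0_negligible_integral (N := `]-oo, 0[%classic : set R))//.
- by rewrite setTD setCitvl.
- exact: gen_ge0.
Qed.

Lemma measurable_u : measurable_fun setT u.
Proof. exact: measurable_powR. Qed.

Lemma u_ge0 y : 0 <= u y. Proof. exact: powR_ge0. Qed.

Lemma ler_u x y : 0 <= x -> x <= y -> u x <= u y.
Proof.
move=> x0 xy; rewrite ge0_ler_powR ?nnegrE// ?(ltW alpha_gt0)//.
exact: le_trans xy.
Qed.

Lemma integrable_u P n : (gen P n).-integrable Rge0 (EFin \o u).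
Proof.
apply/integrableP; split.
  by apply/measurable_EFinP/measurable_funTS; exact: measurable_u.
rewrite (_ : (fun _ => _) = fun y => (u y)%:E); first exact: (gen_int P n).
by apply/funext => y /=; rewrite ger0_norm// u_ge0.
Qed.

(* The integrand of [v], made Hoelder continuous on the whole line by an
   absolute value which is redundant for [0 <= x <= 1] and [0 <= y]. *)
Definition ret n x y : R := u `|1 + x * (y / r n - 1)|.

Lemma measurable_ret n x : measurable_fun setT (ret n x).
Proof.
apply: (measurableT_comp measurable_u); apply: measurableT_comp => //.
apply: measurable_funD => //; apply: measurable_funM => //.
by apply: measurable_funB => //; exact: measurable_funM.
Qed.

Lemma ret_ge0 n x y : 0 <= ret n x y. Proof. exact: u_ge0. Qed.

Lemma ret1 n y : 0 <= y -> ret n 1 y = u (y / r n).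
Proof.
by move=> y0; rewrite /ret mul1r addrC subrK ger0_norm// divr_ge0// ltW.
Qed.

Lemma ret_arg_ge0 n x y : 0 <= x <= 1 -> 0 <= y -> 0 <= 1 + x * (y / r n - 1).
Proof.
move=> /andP[x0 x1] y0; rewrite mulrBr mulr1 addrCA addr_ge0 ?subr_ge0//.
by rewrite mulr_ge0// divr_ge0// ltW.
Qed.

Lemma retE n g y : 0 <= y -> ret n g%:num y = u (1 + g%:num * (y / r n - 1)).
Proof.
move=> y0; rewrite /ret ger0_norm// ret_arg_ge0//; apply/andP; by split.
Qed.

(** The bases differ by [(x - x') * (y / r n - 1)], and subadditivity bounds the power of
    [y / r n + 1] by [1 + ret n 1 y]. *)
Lemma ret_holder n x x' y : 0 <= y ->
  `|ret n x y - ret n x' y| <= `|x - x'| `^ alpha * (1 + ret n 1 y).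
Proof.
move=> y0; apply: (le_trans (powR_norm_holder halpha _ _)).
have -> : 1 + x * (y / r n - 1) - (1 + x' * (y / r n - 1)) =
          (x - x') * (y / r n - 1) by ring.
rewrite normrM powRM// ler_wpM2l ?powR_ge0// (ret1 _ y0).
have yr0 : 0 <= y / r n by rewrite divr_ge0// ltW.
apply: le_trans (_ : (y / r n + 1) `^ alpha <= _).
  rewrite -/(u _) -/(u _) ler_u// (le_trans (ler_normB _ _))//.
  by rewrite normr1 ger0_norm.
by rewrite (le_trans (powRD_le halpha yr0 _))// powR1 addrC.
Qed.

Lemma ret0 n y : ret n 0 y = 1.
Proof. by rewrite /ret mul0r addr0 normr1 /Defs.u powR1. Qed.

Lemma ret_le n x y : 0 <= y ->
  ret n x y <= 1 + `|x| `^ alpha * (1 + ret n 1 y).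
Proof.
move=> y0; have := ret_holder n x 0 y0; rewrite ret0 subr0 => /ler_normlP[_].
by rewrite lerBlDl.
Qed.

(** As [r n >= 1], [ret n 1] is dominated by [u]; then [ret_le] dominates every other fraction. *)
Lemma integrable_ret P n x : (gen P n).-integrable Rge0 (EFin \o ret n x).
Proof.
have int1 : (gen P n).-integrable Rge0 (EFin \o ret n 1).
  apply: (le_integrable _ _ _ (integrable_u P n)) => //.
    by apply/measurable_EFinP/measurable_funTS; exact: measurable_ret.
  move=> y /Rge0P y0; rewrite /= !ger0_norm ?u_ge0 ?ret_ge0// lee_fin ret1//.
  rewrite ler_u//; first by rewrite divr_ge0// ltW.
  by rewrite ler_pdivrMr// ler_peMr.
have intc c : (gen P n).-integrable Rge0 (EFin \o cst c).
  exact: finite_measure_integrable_cst.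
have intb : (gen P n).-integrable Rge0
    (EFin \o (fun y => 1 + `|x| `^ alpha * (1 + ret n 1 y))).
  apply: (eq_integrable _ _ _ _ (integrableD _ (intc 1)
    (integrableZl _ (`|x| `^ alpha) (integrableD _ (intc 1) int1)))) => //.
apply: (le_integrable _ _ _ intb) => //.
  by apply/measurable_EFinP/measurable_funTS; exact: measurable_ret.
move=> y /Rge0P y0; rewrite /= lee_fin ger0_norm ?ret_ge0//.
exact: le_trans (ret_le n x y0) (ler_norm _).
Qed.

(** [v] extended to real fractions, so that continuity and compactness on the real line apply. *)
Definition vR P n x : R := \int[gen P n]_(y in Rge0) ret n x y.

Lemma vRE P n g : v r P n g = vR P n g%:num.
Proof.
apply: eq_Rintegral => y; rewrite inE => /Rge0P y0; exact/esym/retE.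
Qed.

Lemma vR0 P n : vR P n 0 = 1.
Proof.
rewrite /vR (@eq_Rintegral _ _ _ _ _ (cst 1)); last by move=> y _; exact: ret0.
rewrite Rintegral_cst//; transitivity (1 * fine (1 : \bar R)); last by rewrite mulr1.
by congr (_ * fine _); exact: gen_Rge0.
Qed.

Lemma vR_ge0 P n x : 0 <= vR P n x.
Proof. by apply: Rintegral_ge0 => y _; exact: ret_ge0. Qed.

Lemma vR_holder P n x x' :
  `|vR P n x - vR P n x'| <= `|x - x'| `^ alpha * (1 + vR P n 1).
Proof.
have intx := integrable_ret P n x; have intx' := integrable_ret P n x'.
have int1 := integrable_ret P n 1.
have intc : (gen P n).-integrable Rge0 (EFin \o cst 1).
  exact: finite_measure_integrable_cst.
have intB : (gen P n).-integrable Rge0 (EFin \o (fun y => ret n x y - ret n x' y)).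
  exact: (eq_integrable _ _ _ _ (integrableB _ intx intx')).
have intD : (gen P n).-integrable Rge0 (EFin \o (fun y => 1 + ret n 1 y)).
  exact: (eq_integrable _ _ _ _ (integrableD _ intc int1)).
have intM : (gen P n).-integrable Rge0
    (EFin \o (fun y => `|x - x'| `^ alpha * (1 + ret n 1 y))).
  exact: (eq_integrable _ _ _ _ (integrableZl _ (`|x - x'| `^ alpha) intD)).
rewrite /vR -RintegralB// (le_trans (le_normr_Rintegral _ intB))//.
have -> : `|x - x'| `^ alpha * (1 + \int[gen P n]_(y in Rge0) ret n 1 y) =
    \int[gen P n]_(y in Rge0) (`|x - x'| `^ alpha * (1 + ret n 1 y)).
  rewrite RintegralZl// RintegralD//; congr (_ * (_ + _)).
  by rewrite -[LHS](vR0 P n); apply: eq_Rintegral => y _; rewrite ret0.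
apply: le_Rintegral => //.
  exact: (integrable_norm intB).
by move=> y /Rge0P y0; exact: ret_holder.
Qed.

Lemma vR_continuous P n : continuous (vR P n).
Proof.
move=> x; apply/cvgrPdist_lt => e e0.
have C0 : 0 < 1 + vR P n 1 by rewrite ltr_pwDl// vR_ge0.
(* The radius whose [alpha]-th power times the Hoelder constant equals [e]. *)
have d0 : 0 < (e / (1 + vR P n 1)) `^ alpha^-1 by rewrite powR_gt0// divr_gt0.
near=> x'; apply: (le_lt_trans (vR_holder P n x x')).
rewrite -ltr_pdivlMr//.
have -> : e / (1 + vR P n 1) = ((e / (1 + vR P n 1)) `^ alpha^-1) `^ alpha.
  by rewrite -powRrM mulVf ?gt_eqF// powRr1// divr_ge0// ltW.
rewrite gt0_ltr_powR ?nnegrE ?powR_ge0//.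
Unshelve. all: by end_near. Qed.

(** The closed constraint [A] lets the lemma yield both the maximizer itself and the best competitor
    away from it. *)
Lemma vR_argmax P n (A : set R) : closed A -> `[0, 1]%classic `&` A !=set0 ->
  exists2 x, (`[0, 1]%classic `&` A) x &
    forall x', (`[0, 1]%classic `&` A) x' -> vR P n x' <= vR P n x.
Proof.
move=> cA A0.
have cB : compact (`[0, 1]%classic `&` A : set R).
  apply: (subclosed_compact _ (@segment_compact _ 0 1)) => //.
  exact: closedI (@itv_closed _ _ _ _) cA.
have [//|x] := compact_EVT_max A0 cB (f := vR P n).
  exact/continuous_subspaceT/vR_continuous.
by rewrite inE => Bx xmax; exists x => // x' Bx'; apply: xmax; rewrite inE.
Qed.

Lemma i01P x : reflect (exists g : {i01 R}, g%:num = x) (0 <= x <= 1).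
Proof.
apply: (iffP andP) => [[x0 x1]|[g <-]]; first by exists (Itv01 x0 x1).
by split.
Qed.

(** Compactness of [0, 1] makes the set in [gamma_opt] nonempty, so [xget] does not fall back on its
    default. *)
Lemma gamma_opt_max P n g : v r P n g <= v r P n (gamma_opt r P n).
Proof.
have [||x [x01 _] xmax] := @vR_argmax P n setT.
- exact: closedT.
- by exists 0; split => //=; rewrite in_itv/= lexx ler01.
move: x01; rewrite /= in_itv/= => /i01P[h hx].
have : [set g | forall g', v r P n g' <= v r P n g] h.
  move=> g' /=; rewrite !vRE hx; apply: xmax; split => //=.
  by rewrite in_itv/=; apply/i01P; exists g'.
by move=> hmax; exact: (xgetPex 0%:i01 (ex_intro _ h hmax) g).
Qed.

Definition vmax P n : R := v r P n (gamma_opt r P n).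

Lemma vmax_ge1 P n : 1 <= vmax P n.
Proof.
apply: le_trans (gamma_opt_max P n 0%:i01).
by rewrite vRE -[leLHS](vR0 P n).
Qed.

Lemma v_le_vmax P n g : v r P n g <= vmax P n.
Proof. exact: gamma_opt_max. Qed.

(* Strict concavity: the midpoint gap is positive off [r n], which is null. *)
Lemma vR_midpoint_lt P n x x' : gen P n [set r n] = 0%E ->
  0 <= x <= 1 -> 0 <= x' <= 1 -> x != x' ->
  (vR P n x + vR P n x') / 2 < vR P n ((x + x') / 2).
Proof.
move=> null x01 x'01 xx'.
pose gap y := ret n ((x + x') / 2) y - (ret n x y + ret n x' y) / 2.
have gapE y : 1 + (x + x') / 2 * (y / r n - 1) =
    ((1 + x * (y / r n - 1)) + (1 + x' * (y / r n - 1))) / 2.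
  by move: (y / r n) => z; field.
have gap_gt0 y : 0 <= y -> y != r n -> 0 < gap y.
  move=> y0 yr; rewrite subr_gt0 /ret gapE.
  have px := ret_arg_ge0 n x01 y0; have px' := ret_arg_ge0 n x'01 y0.
  rewrite (ger0_norm px) (ger0_norm px') (ger0_norm (divr_ge0 (addr_ge0 px px') _))//.
  apply: powR_midpoint_lt => //.
  rewrite (inj_eq (addrI _)) (inj_eq (mulIf _))//.
  by rewrite subr_eq0 -(inj_eq (mulIf (lt0r_neq0 (r_gt0 n)))) divfK ?mul1r// gt_eqF.
have gap_ge0 y : 0 <= y -> 0 <= gap y.
  move=> y0; have [->|yr] := eqVneq y (r n); last exact/ltW/gap_gt0.
  rewrite /gap /ret divff ?gt_eqF// subrr !mulr0 !addr0; lra.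
have int2 : (gen P n).-integrable Rge0 (EFin \o (fun y => (ret n x y + ret n x' y) * 2^-1)).
  apply: (eq_integrable _ _ _ _ (integrableZl _ 2^-1 (integrableD _ (integrable_ret P n x) (integrable_ret P n x')))) => //.
  by move=> y _ /=; rewrite -EFinD -EFinM mulrC.
have intg : (gen P n).-integrable Rge0 (EFin \o gap).
  exact: (eq_integrable _ _ _ _ (integrableB _ (integrable_ret P n _) int2)).
have -> : (vR P n x + vR P n x') / 2 = \int[gen P n]_(y in Rge0) ((ret n x y + ret n x' y) / 2).
  rewrite RintegralZr//; last first.
    exact: (eq_integrable _ _ _ _ (integrableD _ (integrable_ret P n x) (integrable_ret P n x'))).
  by rewrite RintegralD//; exact: integrable_ret.
rewrite -subr_gt0 /vR -RintegralB//; last exact: integrable_ret.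
rewrite -/gap lt_neqAle Rintegral_ge0 ?andbT; last first.
  by move=> y /Rge0P; exact: gap_ge0.
(* A zero integral would make the gap vanish off a null set [A]; the half-line, of mass 1, would
   then be covered by [A] and the null point [r n]. *)
apply/negP => /eqP I0.
have mgap : measurable_fun Rge0 (EFin \o gap) by have /integrableP[] := intg.
have : (\int[gen P n]_(y in Rge0) `|(gap y)%:E| = 0)%E.
  rewrite (_ : integral _ _ _ = \int[gen P n]_(y in Rge0) (gap y)%:E)%E; last first.
    by apply: eq_integral => y; rewrite inE => /Rge0P y0 /=; rewrite ger0_norm// gap_ge0.
  rewrite -[LHS]fineK; last exact: (integrable_fin_num _ intg).
  by rewrite -[fine _]I0.
move=> /ae_eq_integral_abs -/(_ _ mgap)[]//= A [mA A0 sub].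
have : (gen P n Rge0 <= gen P n (A `|` [set r n]))%E.
  apply: le_measure; rewrite ?inE//; first exact: measurableU.
  move=> y /Rge0P y0; have [->|yr] := eqVneq y (r n); [by right|left].
  apply: sub => /= gy; have := gap_gt0 y y0 yr.
  by have /Rge0P/gy [->] := y0; rewrite ltxx.
rewrite gen_Rge0 measureU0// (_ : _ A = 0%E) ?lee_fin ?ler10//.
Qed.

(** The midpoint of two distinct maximizers would beat the maximum; (FM) supplies the nullity of
    [r n]. *)
Lemma gamma_opt_unique P n g : FM r P ->
  v r P n g = vmax P n -> g = gamma_opt r P n.
Proof.
move=> /(_ n)[_ _ null] vg; apply/val_inj => /=; apply/eqP/negPn/negP => ne.
set h := gamma_opt r P n in ne.
have b (k : {i01 R}) : 0 <= k%:num <= 1 by apply/i01P; exists k.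
have := vR_midpoint_lt null (b g) (b h) ne.
have /i01P[m mE] : 0 <= (g%:num + h%:num) / 2 <= 1.
  have /andP[? ?] := b g; have /andP[? ?] := b h; lra.
rewrite -mE -!vRE vg /vmax -/h (_ : _ / 2 = v r P n h); last by lra.
by rewrite ltNge; case/negP; exact: gamma_opt_max.
Qed.

End growth_factor.

(** * Growth factors under the metric and under mixtures *)

Section metric.
Context {R : realType} (alpha : R) (N : nat) (r : 'I_N -> R).
Hypothesis halpha : 0 < alpha < 1.
Hypothesis hr : forall n, 1 <= r n.
Implicit Types (P Q : Ppsi alpha N) (n : 'I_N) (g : {i01 R}) (x y : R).

Local Notation Rge0 := (`[0, +oo[%classic : set R).

(** With one unit of wealth, fully invested, [eta] is the identity: [r n + (y - r n) = y]. *)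
Lemma ker11 P n U : ker r P n (1, 1) U = gen P n U.
Proof.
rewrite /= /step_measure /pushforward; congr (gen P n _).
by apply/funext => y; rewrite /preimage/= /eta /= mulr1 mul1r addrC subrK.
Qed.

(** The base of the power is Lipschitz in the return with constant [g / r n <= 1]. *)
Lemma Hol_ret n g : Hol alpha (ret alpha r n g%:num).
Proof.
move=> x y _ _; apply: (le_trans (powR_norm_holder halpha _ _)).
rewrite ge0_ler_powR ?nnegrE//; first by case/andP: halpha => /ltW.
have -> : 1 + g%:num * (x / r n - 1) - (1 + g%:num * (y / r n - 1)) =
          g%:num * (r n)^-1 * (x - y) by ring.
rewrite normrM ler_piMl// normrM mulr_ile1//.
  by rewrite ger0_norm.
have r0 : 0 < r n by exact: lt_le_trans (hr n).
by rewrite normfV gtr0_norm// invf_le1.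
Qed.

(* The growth factors are integrals of Hoelder functions against the kernels at
   the point [(1, 1)], where the weight [psi] equals [2]. *)
Lemma v_dist Q P n g :
  (`|v r Q n g - v r P n g|%:E <= 2%:E * dist r Q P)%E.
Proof.
have psi1 : psi alpha 1 = 2 by rewrite /psi /u powR1.
have IE (S : Ppsi alpha N) : \int[ker r S n (1, 1)]_(y in Rge0) ret alpha r n g%:num y = v r S n g.
  rewrite vRE// /vR /Rintegral; congr fine.
  by apply: eq_measure_integral => A _ _; exact: ker11.
rewrite -(@lee_pdivrMl _ 2)//.
apply: le_trans (le_bigmax _ _ n).
apply: le_trans (ereal_sup_ubound _); last first.
  by exists (1, 1) => //; rewrite /D /= ler01 lexx.
rewrite /= psi1 lee_pmul2l//.
apply: ereal_sup_ubound; exists (ret alpha r n g%:num); first exact: Hol_ret.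
by rewrite !IE.
Qed.

Lemma v_dist_lt Q P n g (d : R) : (dist r Q P < d%:E)%E ->
  `|v r Q n g - v r P n g| <= 2 * d.
Proof.
move=> dQP; rewrite -lee_fin (le_trans (v_dist Q P n g))// EFinM.
by rewrite lee_pmul2l// ltW.
Qed.

(** Integrals are affine in the measure, so at a fixed fraction the difference quotient in [t] has
    no remainder. *)
Lemma v_mix (t : {i01 R}) P Q n g :
  v r (mix t P Q) n g = v r P n g + t%:num * (v r Q n g - v r P n g).
Proof.
have fin (S : Ppsi alpha N) : (\int[gen S n]_(y in Rge0) (ret alpha r n g%:num y)%:E \is a fin_num)%E.
  exact: (integrable_fin_num _ (integrable_ret halpha hr S n g%:num)).
rewrite !vRE// /vR /Rintegral [X in fine X](integral_mconv t (gen P n) (gen Q n))//=.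
- rewrite fineD ?fin_numM// !fineM//=; ring.
- by apply/measurable_EFinP/measurable_funTS; exact: measurable_ret.
- by move=> y _; rewrite lee_fin ret_ge0.
Qed.

(** Adding [P] back recovers the kernels on [D], which determine the generating measures. This makes
    the derivative a function of the difference alone. *)
Lemma v_diff_ker P Q Q' n g :
  diff_ker r Q P = diff_ker r Q' P -> v r Q n g = v r Q' n g.
Proof.
move=> QQ'; rewrite /v /Rintegral; congr fine; apply: (eq_measure_integral (gen Q' n)) => A mA _.
apply: (@ker_inj _ _ _ r) => // m xa U Dxa mU.
have := congr1 (fun f => f m xa U) QQ'.
rewrite /diff_ker; case: asboolP => [_ /addIr|[]//].
have fk (S : Ppsi alpha N) : ker r S m xa U \is a fin_num.
  exact: finite_kernel_measure.
by move=> e; rewrite -[LHS]fineK// e fineK.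
Qed.

(** Hoelder comparison with fraction 0, where the growth factor is 1. *)
Lemma v_le_v1 P n g : v r P n g <= 2 + v r P n (one01 R).
Proof.
rewrite !vRE// -[leLHS](subrK (vR r P n 0)) {2}vR0// addrC -[2]/(1 + 1) -addrA.
rewrite lerD2l (le_trans (ler_norm _))// (le_trans (vR_holder _ _ _ _ _ _))//.
rewrite subr0 ler_piMl ?addr_ge0 ?vR_ge0// ger0_norm//.
have -> : (1 : R) = 1 `^ alpha by rewrite powR1.
rewrite ge0_ler_powR ?nnegrE//.
by case/andP: halpha => /ltW.
Qed.

End metric.

(** * First-order expansion of finite products *)

Section product_rule.
Context {R : realType}.

(** One strict inequality would make the whole product strictly smaller. This turns optimality of a
    product into optimality of each factor. *)
Lemma prod_eq_pointwise (I : finType) (f g : I -> R) :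
  (forall i, 0 <= f i <= g i) -> (forall i, 0 < g i) ->
  \prod_i f i = \prod_i g i -> f =1 g.
Proof.
move=> fg g0 pE n; have [f0 fgn] := andP (fg n).
apply/eqP; rewrite eq_le fgn leNgt; apply/negP => lt.
suff : \prod_i f i < \prod_i g i by rewrite pE ltxx.
rewrite (bigD1 n) 1?[ltRHS](bigD1 n) //=.
apply: (@le_lt_trans _ _ (f n * \prod_(i | i != n) g i)).
  by rewrite ler_wpM2l//; exact: ler_prod.
by rewrite ltr_pM2r// prodr_gt0.
Qed.

(** Induction on the list: if the tail has remainder [rho] and first-order sum [S], prepending [x]
    gives the remainder [(a x + e * d x) * rho + e ^+ 2 * (d x * S)]. *)
Lemma prod_first_order (I : eqType) (s : seq I) (a : I -> R) (C : R) :
  uniq s -> exists K, forall (e : R) (d : I -> R), 0 <= e <= 1 ->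
    (forall i, `|d i| <= C) ->
    `|\prod_(i <- s) (a i + e * d i) - \prod_(i <- s) a i -
      e * \sum_(k <- s) d k * \prod_(j <- s | j != k) a j| <= K * e ^+ 2.
Proof.
elim: s => [_|x s IH /andP[xs us]].
  exists 0 => e d _ _; by rewrite !big_nil mulr0 subr0 subrr normr0 mul0r.
have [K HK] := IH us.
pose B := \sum_(k <- s) `|\prod_(j <- s | j != k) a j|.
(* The first summand bounds the term with [rho], using [e <= 1]; the second bounds [d x * S]. *)
exists ((`|a x| + C) * K + C * (C * B)) => e d e01 dC.
have [e0 e1] := andP e01.
have prodx : \prod_(j <- s | j != x) a j = \prod_(j <- s) a j.
  rewrite -big_filter; congr bigop; apply/all_filterP/allP => j js /=.
  by apply: contraNneq xs => <-.
pose S := \sum_(k <- s) d k * \prod_(j <- s | j != k) a j.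
pose A := \prod_(i <- s) a i.
pose rho := \prod_(i <- s) (a i + e * d i) - A - e * S.
have sumE : \sum_(k <- x :: s) d k * \prod_(j <- x :: s | j != k) a j =
    d x * A + a x * S.
  rewrite big_cons big_cons eqxx prodx; congr (_ + _).
  rewrite /S mulr_sumr; apply: eq_big_seq => k ks.
  rewrite big_cons ifT; first by rewrite mulrCA.
  by apply: contraNneq xs => ->.
rewrite sumE !big_cons -/A.
have -> : (a x + e * d x) * \prod_(i <- s) (a i + e * d i) - a x * A -
    e * (d x * A + a x * S) = (a x + e * d x) * rho + e ^+ 2 * (d x * S).
  by rewrite /rho; move: (\prod_(i <- s) (a i + e * d i)) => p; ring.
have C0 : 0 <= C := le_trans (normr_ge0 _) (dC x).
have SB : `|S| <= C * B.
  rewrite (le_trans (ler_norm_sum _ _ _))// /B mulr_sumr ler_sum// => k _.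
  by rewrite normrM ler_wpM2r.
rewrite (le_trans (ler_normD _ _))// [leRHS]mulrDl lerD//.
  rewrite normrM -mulrA ler_pM// ?HK//.
  rewrite (le_trans (ler_normD _ _))// lerD2l normrM ger0_norm//.
  by rewrite (le_trans (ler_wpM2l e0 (dC x)))// ler_piMl.
have e20 : 0 <= e ^+ 2 by rewrite exprn_ge0.
by rewrite normrM (ger0_norm e20) mulrC ler_wpM2r// normrM ler_pM.
Qed.

(** With [d] the difference quotients of the factors, [M = a + eps * d] is expanded to first order.
    The quadratic remainder and the replacement of [d] by [D] each cost less than [e / 2], uniformly
    over [K]. *)
Lemma prod_difference_quotient (I : finType) (T : Type) (K : set T) (a : I -> R)
    (M : nat -> T -> I -> R) (D : T -> I -> R) (C : R) (eps : nat -> R) :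
  (forall Q i, K Q -> `|D Q i| <= C) ->
  (forall m, 0 < eps m <= 1) -> eps @ \oo --> (0 : R) ->
  (forall i (e : R), 0 < e -> \forall m \near \oo, forall Q, K Q ->
    `|(M m Q i - a i) / eps m - D Q i| < e) ->
  forall e : R, 0 < e -> \forall m \near \oo, forall Q, K Q ->
    `|(\prod_i M m Q i - \prod_i a i) / eps m -
      \sum_k D Q k * \prod_(j | j != k) a j| < e.
Proof.
move=> DC eps01 eps0 DM e e0.
have [L HL] := prod_first_order a (C + 1) (index_enum_uniq I).
pose B := \sum_k `|\prod_(j | j != k) a j|.
have B0 : 0 <= B by apply: sumr_ge0.
(* The bound 1 gives [|d| <= C + 1]; the other bound controls the replacement of [d] by [D]. *)
pose eta := Num.min 1 (e / 2 / (1 + B)).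
have eta0 : 0 < eta.
  by rewrite lt_min ltr01 !divr_gt0// ltr_pwDl.
have eps_small : \forall m \near \oo, eps m < e / 2 / (1 + `|L|).
  have b0 : 0 < e / 2 / (1 + `|L|) by rewrite !divr_gt0// ltr_pwDl.
  have /cvgr0Pnorm_lt/(_ _ b0) := eps0; apply: filterS => m.
  by apply: le_lt_trans; exact: ler_norm.
have all_small : \forall m \near \oo, forall i Q, K Q ->
    `|(M m Q i - a i) / eps m - D Q i| < eta.
  by apply: filter_forall => i; exact: DM.
near=> m => Q KQ.
have [em em1] := andP (eps01 m).
pose d i := (M m Q i - a i) / eps m.
have dD i : `|d i - D Q i| < eta.
  by move: i Q KQ @d; near: m.
have dC i : `|d i| <= C + 1.
  rewrite -[d i](subrK (D Q i)) addrC (le_trans (ler_normD _ _))// lerD ?DC//.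
  by rewrite (le_trans (ltW (dD i)))// ge_min lexx.
have ME i : M m Q i = a i + eps m * d i.
  by rewrite /d mulrC divfK ?gt_eqF// addrC subrK.
have em01 : 0 <= eps m <= 1 by rewrite ltW.
have := HL (eps m) d em01 dC.
rewrite -(eq_bigr _ (fun i _ => ME i)).
set p := \prod_i M m Q i; set q := \prod_i a i.
set S := \sum_k d k * _; set S' := \sum_k D Q k * _ => H.
have H1 : `|(p - q) / eps m - S| <= e / 2 * (`|L| / (1 + `|L|)).
  have -> : (p - q) / eps m - S = (p - q - eps m * S) / eps m.
    by rewrite [RHS]mulrBl [eps m * S]mulrC mulfK ?gt_eqF.
  rewrite normrM normfV (gtr0_norm em) ler_pdivrMr// (le_trans H)//.
  rewrite expr2 mulrA ler_wpM2r ?(ltW em)//.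
  rewrite (le_trans (ler_wpM2r (ltW em) (ler_norm L)))//.
  rewrite mulrCA ler_wpM2l//; apply/ltW; near: m; exact: eps_small.
have H2 : `|S - S'| <= e / 2 * (B / (1 + B)).
  rewrite -sumrB (le_trans (ler_norm_sum _ _ _))//.
  rewrite mulrCA /B mulr_suml ler_sum// => k _.
  rewrite -mulrBl normrM mulrC ler_wpM2l// (le_trans (ltW (dD k)))//.
  by rewrite ge_min lexx orbT.
(* The added 1 keeps both errors strictly below [e / 2], with denominators that cannot vanish. *)
have lt1 (x : R) : 0 <= x -> e / 2 * (x / (1 + x)) < e / 2.
  by move=> x0; rewrite gtr_pMr ?divr_gt0// ltr_pdivrMr ?mul1r ?ltrDr ?ltr_pwDl.
have -> : (p - q) / eps m - S' = ((p - q) / eps m - S) + (S - S').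
  by rewrite addrA subrK.
rewrite (le_lt_trans (ler_normD _ _))// [ltRHS](splitr e).
by rewrite ltrD// ?(le_lt_trans H1) ?(le_lt_trans H2)// lt1.
Unshelve. all: by end_near. Qed.

End product_rule.

(* Otherwise unification compares two growth factors by unfolding integrals. *)
Local Opaque v.

(** * Expected terminal utility as a product of growth factors *)

Section expectation.
Context {R : realType} (alpha : R) (N : nat) (r : 'I_N -> R).
Hypothesis halpha : 0 < alpha < 1.
Hypothesis hr : forall n, 1 <= r n.
Implicit Types (P : Ppsi alpha N) (pi : strategy R N) (n : 'I_N) (g : {i01 R}).

Local Notation Rge0 := (`[0, +oo[%classic : set R).
Local Notation u := (u alpha).

Let r_gt0 n : 0 < r n. Proof. exact: lt_le_trans (hr n). Qed.

(** The second marginal of a product kernel is the composed kernel. *)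
Lemma integral_pkproduct_snd d0 d1 d2 (T0 : measurableType d0)
    (T1 : measurableType d1) (T2 : measurableType d2)
    (k1 : R.-pker T0 ~> T1) (k2 : R.-pker (T0 * T1) ~> T2) x (f : T2 -> \bar R) :
  measurable_fun setT f -> (forall z, 0 <= f z)%E ->
  (\int[pkproduct k1 k2 x]_w f w.2 = \int[k1 x]_y \int[k2 (x, y)]_z f z)%E.
Proof.
move=> mf f0; rewrite -integral_kcomp//.
transitivity (\int[pushforward (pkproduct k1 k2 x) snd]_z f z)%E.
  by rewrite ge0_integral_pushforward.
apply: eq_measure_integral => A mA _.
rewrite /= /pushforward /pkproduct /mkproduct /= /kproduct /kcomp.
apply: eq_integral => y _.
by rewrite /kernel.intker_indic/= integral_indic// setIT.
Qed.

Section law.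
Variables (P : Ppsi alpha N) (pi : strategy R N) (x0 : R).
Hypothesis hx0 : 0 <= x0.

Lemma integral_transition n x (f : R -> \bar R) :
  measurable_fun setT f -> (forall z, 0 <= f z)%E ->
  (\int[transition r P pi n x]_z f z =
   \int[gen P n]_(y in Rge0) f (eta (r n) (x, act pi n x) y))%E.
Proof.
move=> mf f0.
have meta : measurable_fun setT (eta (r n) (x, act pi n x)).
  by apply: measurable_funD => //; apply: measurable_funM => //; exact: measurable_funB.
rewrite -ge0_integral_gen//; last exact: measurableT_comp.
exact: ge0_integral_pushforward.
Qed.

Lemma measurable_integral_transition n (f : R -> \bar R) :
  measurable_fun setT f -> (forall z, 0 <= f z)%E ->
  measurable_fun setT (fun x => \int[transition r P pi n x]_z f z)%E.
Proof.
move=> mf f0; apply: measurable_fun_integral_kernel => // U mU.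
exact: (measurable_kernel (transition r P pi n) U mU).
Qed.

Lemma integral_transition_ge0 n x (f : R -> \bar R) :
  (forall z, 0 <= f z)%E -> (0 <= \int[transition r P pi n x]_z f z)%E.
Proof. by move=> f0; exact: integral_ge0. Qed.

Lemma integral_law_step k (kN : (k < N)%N) (f : R -> \bar R) :
  measurable_fun setT f -> (forall z, 0 <= f z)%E ->
  (\int[path_law r P pi kN x0]_w f (path_end w) =
   \int[path_law r P pi (ltnW kN) x0]_w
     \int[transition r P pi (Ordinal kN) (path_end w)]_z f z)%E.
Proof. by move=> mf f0; rewrite /= integral_pkproduct_snd. Qed.

(** Admissible actions keep wealth nonnegative; the induction carries the comparison on nonnegative
    states one step back through the transition kernel. *)
Lemma le_integral_law k (kN : (k <= N)%N) (f1 f2 : R -> \bar R) :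
  measurable_fun setT f1 -> (forall z, 0 <= f1 z)%E ->
  measurable_fun setT f2 -> (forall z, 0 <= f2 z)%E ->
  (forall x, (0 <= x)%R -> f1 x <= f2 x)%E ->
  (\int[path_law r P pi kN x0]_w f1 (path_end w) <=
   \int[path_law r P pi kN x0]_w f2 (path_end w))%E.
Proof.
elim: k kN f1 f2 => [|k IH] kN f1 f2 mf1 f10 mf2 f20 f12.
  by rewrite /= /kdirac !integral_dirac// !diracT !mul1e f12.
rewrite !integral_law_step//; apply: (IH (ltnW kN)
  (fun x => \int[transition r P pi (Ordinal kN) x]_z f1 z)%E
  (fun x => \int[transition r P pi (Ordinal kN) x]_z f2 z)%E).
- exact: measurable_integral_transition.
- by move=> x; exact: integral_transition_ge0.
- exact: measurable_integral_transition.
- by move=> x; exact: integral_transition_ge0.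
move=> x x_ge0; set n := Ordinal kN; rewrite !integral_transition//.
have meta : measurable_fun setT (eta (r n) (x, act pi n x)).
  by apply: measurable_funD => //; apply: measurable_funM => //; exact: measurable_funB.
apply: ge0_le_integral => //.
- by apply: measurable_funTS; exact: measurableT_comp.
- by apply: measurable_funTS; exact: measurableT_comp.
move=> y /Rge0P y0; apply: f12; have /andP[a0 ax] := act_admissible pi n x_ge0.
(* The next wealth is [a * y + r n * (x - a)], where [a] is the action. *)
rewrite /eta /= mulrBr addrC -addrA (mulrC _ (r n)) addr_ge0 ?mulr_ge0//.
by rewrite addrC -mulrBr mulr_ge0 ?subr_ge0// ltW.
Qed.

Lemma eq_integral_law k (kN : (k <= N)%N) (f1 f2 : R -> \bar R) :
  measurable_fun setT f1 -> (forall z, 0 <= f1 z)%E ->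
  measurable_fun setT f2 -> (forall z, 0 <= f2 z)%E ->
  (forall x, (0 <= x)%R -> f1 x = f2 x)%E ->
  (\int[path_law r P pi kN x0]_w f1 (path_end w) =
   \int[path_law r P pi kN x0]_w f2 (path_end w))%E.
Proof.
move=> mf1 f10 mf2 f20 f12; apply/eqP; rewrite eq_le; apply/andP.
by split; apply: le_integral_law => // x x_ge0; rewrite f12.
Qed.

Variable c : 'I_N -> R.
Hypothesis c0 : forall n, 0 <= c n.

Let mu : measurable_fun setT (EFin \o u).
Proof. by apply/measurable_EFinP; exact: measurable_u. Qed.

Let u0 x : (0 <= (EFin \o u) x)%E.
Proof. by rewrite /= lee_fin u_ge0. Qed.

Let prodS k (kN : (k < N)%N) : \prod_(i < N | (i < k.+1)%N) c i =
  c (Ordinal kN) * \prod_(i < N | (i < k)%N) c i.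
Proof.
rewrite (bigD1 (Ordinal kN))//=; congr (_ * _); apply: eq_bigl => i.
by rewrite -val_eqE /= ltnS ltn_neqAle andbC.
Qed.

Let cu k (kN : (k <= N)%N) b : 0 <= b ->
  (\int[path_law r P pi kN x0]_w (b * u (path_end w))%:E =
   b%:E * \int[path_law r P pi kN x0]_w (u (path_end w))%:E)%E.
Proof.
move=> b0; under eq_integral do rewrite EFinM.
rewrite ge0_integralZl_EFin//.
  by move=> w _; rewrite lee_fin u_ge0.
apply/measurable_EFinP.
exact: (measurableT_comp (measurable_u alpha) (@measurable_path_end R k)).
Qed.

Let mcu b : measurable_fun setT (fun x => (b * u x)%:E).
Proof.
by apply/measurable_EFinP/measurable_funM => //; exact: measurable_u.
Qed.

(** One transition turns [u] into at most a multiple of [u], so after peeling off the last period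
    the induction closes on [u] itself. *)
Lemma integral_law_u_le :
  (forall n x, (0 <= x)%R ->
    \int[transition r P pi n x]_z (u z)%:E <= (c n * u x)%:E)%E ->
  forall k (kN : (k <= N)%N),
  (\int[path_law r P pi kN x0]_w (u (path_end w))%:E <=
   (\prod_(i < N | (i < k)%N) c i * u x0)%:E)%E.
Proof.
move=> hc; elim=> [|k IH] kN.
  by rewrite /= /kdirac integral_dirac// ?diracT ?mul1e ?big_pred0 ?mul1r//.
rewrite (integral_law_step kN mu u0).
apply: le_trans (le_integral_law (ltnW kN)
  (measurable_integral_transition (Ordinal kN) mu u0) _ (mcu (c (Ordinal kN))) _
  (hc (Ordinal kN))) _.
- by move=> x; exact: integral_transition_ge0.
- by move=> x; rewrite lee_fin mulr_ge0 ?u_ge0.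
- by rewrite cu// prodS -mulrA EFinM lee_wpmul2l// lee_fin.
Qed.

Lemma integral_law_u :
  (forall n x, (0 <= x)%R ->
    \int[transition r P pi n x]_z (u z)%:E = (c n * u x)%:E)%E ->
  forall k (kN : (k <= N)%N),
  (\int[path_law r P pi kN x0]_w (u (path_end w))%:E =
   (\prod_(i < N | (i < k)%N) c i * u x0)%:E)%E.
Proof.
move=> hc; elim=> [|k IH] kN.
  by rewrite /= /kdirac integral_dirac// ?diracT ?mul1e ?big_pred0 ?mul1r//.
rewrite (integral_law_step kN mu u0).
rewrite (eq_integral_law (ltnW kN)
  (measurable_integral_transition (Ordinal kN) mu u0) _ (mcu (c (Ordinal kN))) _
  (hc (Ordinal kN))).
- by rewrite cu// prodS -mulrA EFinM IH.
- by move=> x; exact: integral_transition_ge0.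
- by move=> x; rewrite lee_fin mulr_ge0 ?u_ge0.
Qed.

End law.

(** Homogeneity: [r n * x + g * x * (y - r n) = r n * x * (1 + g * (y / r n - 1))]. The fraction [g]
    is tied to the single state [x], which covers arbitrary strategies. *)
Lemma integral_transition_u P pi n x (g : {i01 R}) :
  0 <= x -> act pi n x = g%:num * x ->
  (\int[transition r P pi n x]_z (u z)%:E = (u (r n) * v r P n g * u x)%:E)%E.
Proof.
move=> x0 ax.
rewrite (integral_transition _ _ _ _ (f := EFin \o u)); last 2 first.
- by apply/measurable_EFinP; exact: measurable_u.
- by move=> z; rewrite lee_fin u_ge0.
transitivity (\int[gen P n]_(y in Rge0) ((u (r n) * u x) * ret alpha r n g%:num y)%:E)%E.
  apply: eq_integral => y; rewrite inE => /Rge0P y0 /=; congr _%:E.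
  have b : 0 <= g%:num <= 1 by apply/i01P; exists g.
  rewrite (retE alpha hr)// -!powRM ?mulr_ge0// ?ret_arg_ge0// ?(ltW (r_gt0 n))//.
  congr (u _); rewrite /eta /= ax.
  have := r_gt0 n; move: (r n) => s s0; field; exact: lt0r_neq0.
have intr := integrable_ret halpha hr P n g%:num.
rewrite -[LHS]fineK; last first.
  by apply: integrable_fin_num => //; exact: (eq_integrable _ _ _ _ (integrableZl _ _ intr)).
congr _%:E; rewrite -/(Rintegral _ _ _) RintegralZl// mulrAC vRE//.
Qed.

(** Homogeneity of [u] on nonnegative states, transferred to the law by [eq_integral_law]. *)
Lemma policy_valueE P pi x0 : 0 <= x0 ->
  (policy_value r x0 pi P = (u (bond r))^-1%:E *
    \int[path_law r P pi (leqnn N) x0]_w (u (path_end w))%:E)%E.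
Proof.
move=> hx0.
have b0 : 0 < bond r by rewrite /bond prodr_gt0.
have mu b : measurable_fun setT (fun x : R => (u (b * x))%:E).
  apply/measurable_EFinP; apply: (measurableT_comp (measurable_u _)).
  exact: measurable_funM.
rewrite -ge0_integralZl_EFin ?invr_ge0 ?u_ge0//; last 2 first.
- by move=> w _; rewrite lee_fin u_ge0.
- apply/measurable_EFinP.
  exact: (measurableT_comp (measurable_u alpha) (@measurable_path_end R N)).
apply: (eq_integral_law P pi hx0 (leqnn N) (f1 := fun x => (u (x / bond r))%:E)
  (f2 := fun x => ((u (bond r))^-1%:E * (u x)%:E)%E)).
- under eq_fun do rewrite mulrC; exact: mu.
- by move=> x; rewrite lee_fin u_ge0.
- by apply/measurable_EFinP/measurable_funM => //; exact: measurable_u.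
- by move=> x; rewrite lee_fin mulr_ge0 ?invr_ge0 ?u_ge0.
move=> x x_ge0; rewrite -EFinM; congr _%:E.
rewrite /Defs.u powRM// ?invr_ge0 ?(ltW b0)// mulrC; congr (_ * _).
by rewrite -powR_inv1 ?(ltW b0)// -powRrM mulN1r powRN.
Qed.

Lemma u_bond : u (bond r) = \prod_(n < N) u (r n).
Proof.
rewrite /bond; suff [] : u (\prod_(n < N) r n) = \prod_(n < N) u (r n) /\ 0 <= \prod_(n < N) r n by [].
elim/big_rec2: _ => [|n y z _ [IH z0]]; first by rewrite /Defs.u powR1.
by rewrite mulr_ge0 ?(ltW (r_gt0 n))// /Defs.u powRM ?(ltW (r_gt0 n))// -IH.
Qed.

Lemma u_bond_gt0 : 0 < u (bond r).
Proof. by rewrite powR_gt0// prodr_gt0. Qed.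

(** The riskless factors [u (r i)] of the one-step integrals cancel against the discounting. *)
Let normalize (c : 'I_N -> R) y :
  (u (bond r))^-1 * (\prod_(i < N | (i < N)%N) (u (r i) * c i) * y) =
  \prod_(i < N) c i * y.
Proof.
rewrite (eq_bigl xpredT); last by move=> i; rewrite ltn_ord.
by rewrite big_split/= -u_bond !mulrA mulVf ?mul1r// gt_eqF// u_bond_gt0.
Qed.

Lemma policy_value_lin P (gamma : 'I_N -> {i01 R}) x0 : 0 <= x0 ->
  policy_value r x0 (lin gamma) P =
  (\prod_(n < N) v r P n (gamma n) * u x0)%:E.
Proof.
move=> hx0; rewrite policy_valueE//.
rewrite (@integral_law_u _ _ _ hx0 (fun n => u (r n) * v r P n (gamma n))).
- by rewrite -EFinM normalize.
- by move=> n; rewrite mulr_ge0 ?u_ge0// vRE// vR_ge0.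
- by move=> n x x_ge0; exact: integral_transition_u.
Qed.

(** In every nonnegative state the action is some fraction of wealth, so period [n] contributes at
    most the factor [u (r n) * vmax r P n]. *)
Lemma policy_value_le P pi x0 : 0 <= x0 ->
  (policy_value r x0 pi P <= (\prod_(n < N) vmax r P n * u x0)%:E)%E.
Proof.
move=> hx0; rewrite policy_valueE// -normalize EFinM lee_wpmul2l//.
  by rewrite lee_fin invr_ge0 u_ge0.
have vm0 n : 0 <= vmax r P n by rewrite (le_trans _ (vmax_ge1 _ _ _ _)).
apply: (@integral_law_u_le _ _ _ hx0 (fun n => u (r n) * vmax r P n)).
  by move=> n; rewrite mulr_ge0 ?u_ge0.
move=> n x x_ge0; have /andP[a0 ax] := act_admissible pi n x_ge0.
(* At zero wealth the quotient is 0 by convention, and 0 is then the only admissible action. *)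
have /i01P[g gE] : 0 <= act pi n x / x <= 1.
  rewrite divr_ge0//=; move: x_ge0; rewrite le_eqVlt => /predU1P[<-|x_gt0].
    by rewrite invr0 mulr0.
  by rewrite ler_pdivrMr// mul1r.
have ax' : act pi n x = g%:num * x.
  rewrite gE; have [x00|x00] := eqVneq x 0; last by rewrite divfK.
  by move: a0 ax; rewrite x00 mulr0 => a0 ax; apply/eqP; rewrite eq_le ax a0.
rewrite (integral_transition_u P x_ge0 ax') lee_fin.
have vg := v_le_vmax halpha hr P n g.
exact: (ler_wpM2r (u_ge0 _ _) (ler_wpM2l (u_ge0 _ _) vg)).
Qed.

Lemma valueE P x0 : 0 <= x0 ->
  value r x0 P = (\prod_(n < N) vmax r P n * u x0)%:E.
Proof.
move=> hx0; apply/eqP; rewrite eq_le; apply/andP; split.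
  by apply: ge_ereal_sup => _ [pi _ <-]; exact: policy_value_le.
apply: ereal_sup_ubound; exists (lin (gamma_opt r P)) => //.
exact: policy_value_lin.
Qed.

(** At initial state 1 optimality equates two products, hence their factors, and each maximizer is
    unique. Thus the supremum in (ii) runs over one strategy. *)
Lemma optimal_lin P (gamma : 'I_N -> {i01 R}) : FM r P ->
  optimal r P (lin gamma) <-> gamma = gamma_opt r P.
Proof.
move=> hP; split=> [/(_ 1 ler01)|->]; last first.
  by move=> x hx; rewrite policy_value_lin// valueE.
rewrite (policy_value_lin P gamma ler01) (valueE P ler01) => /eqP.
rewrite eqe (_ : u 1 = 1); last by rewrite /Defs.u powR1.
rewrite (mulr1 (\prod_(n < N) v r P n (gamma n))) (mulr1 (\prod_(n < N) vmax r P n)).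
move=> /eqP/prod_eq_pointwise vE.
apply/funext => n; apply: (gamma_opt_unique halpha hr hP); apply: vE => m.
  by rewrite v_le_vmax// andbT vRE// vR_ge0.
exact: lt_le_trans ltr01 (vmax_ge1 halpha hr P m).
Qed.

End expectation.

(** * Uniform difference quotients and differentiability *)

Section differentiability.
Context {R : realType} (alpha : R) (N : nat) (r : 'I_N -> R).
Hypothesis halpha : 0 < alpha < 1.
Hypothesis hr : forall n, 1 <= r n.
Implicit Types (P Q : Ppsi alpha N) (n : 'I_N) (g : {i01 R}).

Lemma v_ge0 P n g : 0 <= v r P n g.
Proof. by rewrite vRE// vR_ge0. Qed.

Lemma v_holder P n g g' :
  `|v r P n g - v r P n g'| <= `|g%:num - g'%:num| `^ alpha * (1 + v r P n (one01 R)).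
Proof. by rewrite !vRE//; exact: vR_holder. Qed.

(** Meant for growth factors [p], [q] at one fraction and [p1], [q1] at full investment, related by
    [v_le_v1]. *)
Let norm_diff_le (p q p1 q1 c : R) : 0 <= p -> p <= 2 + p1 -> 0 <= q ->
  q <= 2 + q1 -> 0 <= q1 -> q1 <= c -> `|q - p| <= c + p1 + 4.
Proof. by rewrite ler_norml => *; apply/andP; split; lra. Qed.

(** The fractions at distance at least [d] form a compact set, whose best value lies below the
    maximum by uniqueness. *)
Lemma gamma_opt_separated P n (d : R) : FM r P -> 0 < d ->
  exists2 rho, 0 < rho & forall g, d <= `|g%:num - (gamma_opt r P n)%:num| ->
    v r P n g <= vmax r P n - rho.
Proof.
move=> hP d0; set h := gamma_opt r P n.
pose A := [set x : R | d <= `|x - h%:num|].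
have cA : closed A.
  rewrite (_ : A = (fun x => `|x - h%:num|) @^-1` [set y | d <= y]) //.
  apply: closed_comp; last exact: closed_ge.
  move=> x _; apply: (@continuous_comp _ _ _ (fun x => x - h%:num) Num.norm).
    by apply: continuousB; [exact: cvg_id|exact: cvg_cst].
  exact: norm_continuous.
have inA g : d <= `|g%:num - h%:num| -> (`[0, 1]%classic `&` A) g%:num.
  by move=> dg; split => //=; rewrite in_itv/=; apply/i01P; exists g.
have [A0|A0] := pselect (`[0, 1]%classic `&` A !=set0); last first.
  (* No fraction is that far away, so any [rho] works. *)
  by exists 1 => // g /inA gA; exfalso; apply: A0; exists g%:num.
have [x [x01 dx] xmax] := vR_argmax halpha hr P n cA A0.
move: x01; rewrite /= in_itv/= => /i01P[g gE].
exists (vmax r P n - v r P n g).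
  rewrite subr_gt0 lt_neqAle v_le_vmax// andbT; apply/eqP => vg.
  have gh := gamma_opt_unique halpha hr hP vg.
  by move: dx; rewrite /A /= -gE gh -/h subrr normr0 leNgt d0.
move=> g' /inA g'A; rewrite subKr (vRE hr) (vRE hr) gE; exact: xmax.
Qed.

(* The quotient lies between the values of [v Q - v P] at the maximizers for [P]
   and for the mixture, and the latter are close to each other uniformly in [Q]
   by the separation of the maximizer. *)
Lemma vmax_difference_quotient P n (C e : R) : FM r P -> 0 < e ->
  exists2 t0, 0 < t0 & forall (t : {i01 R}) Q, 0 < t%:num < t0 ->
    v r Q n (one01 R) <= C ->
    `|(vmax r (mix t P Q) n - vmax r P n) / t%:num -
      (v r Q n (gamma_opt r P n) - v r P n (gamma_opt r P n))| < e.
Proof.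
move=> hP e0.
have e2 : e / 2 < e by lra.
have add2_le (p q c : R) : q <= c -> 1 + q + (1 + p) <= c + p + 4 by lra.
set h := gamma_opt r P n.
(* [L] bounds every [|D g|] as well as the sum of the Hoelder constants for [P] and [Q]; below, [d]
   is chosen so that its [alpha]-th power times [L] is [e / 2]. *)
pose L := `|C| + v r P n (one01 R) + 4.
have v1 := v_ge0 P n (one01 R).
have L0 : 0 < L by rewrite ltr_wpDl// addr_ge0.
pose d := (e / 2 / L) `^ alpha^-1.
have a0 : 0 < alpha by case/andP: halpha.
have eL : 0 < e / 2 / L by rewrite !divr_gt0.
have d0 : 0 < d by rewrite powR_gt0.
have dE : d `^ alpha = e / 2 / L.
  by rewrite /d -powRrM mulVf ?gt_eqF// powRr1// ltW.
have [rho rho0 sep] := gamma_opt_separated n hP d0.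
exists (rho / (2 * L)); first by rewrite divr_gt0// mulr_gt0.
move=> t Q /andP[t_gt0 t_lt] QC.
have QL : v r Q n (one01 R) <= `|C| := le_trans QC (ler_norm C).
pose D g := v r Q n g - v r P n g.
have DL g : `|D g| <= L.
  by apply: (norm_diff_le _ _ _ _ _ QL);
    [exact: v_ge0|exact: v_le_v1|exact: v_ge0|exact: v_le_v1|exact: v_ge0].
have Dh g : `|g%:num - h%:num| < d -> `|D g - D h| <= e / 2.
  move=> gd; have -> : D g - D h = (v r Q n g - v r Q n h) - (v r P n g - v r P n h).
    by rewrite /D opprD addrACA -opprD.
  rewrite (le_trans (ler_normB _ _))// (le_trans (lerD (v_holder _ _ _ _) (v_holder _ _ _ _)))//.
  rewrite -mulrDr -[leRHS](divfK (lt0r_neq0 L0)) -dE ler_pM ?powR_ge0//.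
  - by rewrite !addr_ge0// v_ge0.
  - by rewrite ge0_ler_powR ?nnegrE ?(ltW a0)// ltW.
  - exact: add2_le.
set g := gamma_opt r (mix t P Q) n.
have mE k : v r (mix t P Q) n k = v r P n k + t%:num * D k by exact: v_mix.
have vmE : vmax r (mix t P Q) n = v r P n g + t%:num * D g by rewrite -mE.
have hE : v r P n h = vmax r P n by [].
have lo : vmax r P n + t%:num * D h <= vmax r (mix t P Q) n.
  by rewrite -hE -mE; exact: v_le_vmax.
have up : v r P n g <= vmax r P n by exact: v_le_vmax.
have gd : `|g%:num - h%:num| < d.
  (* Otherwise [g] loses at least [rho] under [P] and gains at most [2 * L * t < rho] over [h] from
     the perturbation, so it could not be optimal for the mixture. *)
  rewrite ltNge; apply/negP => /sep gsep.
  have : t%:num * (D g - D h) < rho.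
    rewrite (le_lt_trans (ler_norm _))// normrM (gtr0_norm t_gt0).
    rewrite (@le_lt_trans _ _ (t%:num * (2 * L)))//; last first.
      by rewrite -ltr_pdivlMr// mulr_gt0.
    rewrite ler_wpM2l ?(ltW t_gt0)// (le_trans (ler_normB _ _))//.
    by rewrite mulr_natl mulr2n lerD.
  apply/negP; rewrite -leNgt mulrBr; move: lo; rewrite vmE => lo.
  have := le_trans lo (lerD gsep (lexx (t%:num * D g))).
  by rewrite -addrA lerD2l addrC lerBrDr -lerBrDl.
have := Dh g gd; set q := (_ - _) / _ => Dgh.
have q1 : D h <= q.
  by rewrite /q (ler_pdivlMr _ _ t_gt0) lerBrDl [D h * _]mulrC.
have q2 : q <= D g.
  by rewrite /q (ler_pdivrMr _ _ t_gt0) vmE lerBlDr [D g * _]mulrC [leRHS]addrC lerD2r.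
rewrite -/(D h) ger0_norm ?subr_ge0//.
by rewrite (le_lt_trans (lerB q2 (lexx (D h))))// (le_lt_trans (ler_norm _))// (le_lt_trans Dgh).
Qed.

(** A bound at full investment controls growth factors and Hoelder constants at all fractions;
    bounded and relatively compact families both have one. *)
Definition v_bounded (K : set (Ppsi alpha N)) :=
  exists C : R, forall Q n, K Q -> v r Q n (one01 R) <= C.

Lemma bounded_family_v_bounded K : bounded_family r K -> v_bounded K.
Proof.
move=> [P' [d [d0 Kd]]]; exists (\sum_n v r P' n (one01 R) + 2 * d) => Q n KQ.
have : `|v r Q n (one01 R) - v r P' n (one01 R)| <= 2 * d.
  rewrite -lee_fin (le_trans (v_dist halpha hr Q P' n _))// EFinM.
  by rewrite lee_pmul2l// Kd.
move=> /(le_trans (ler_norm _)); rewrite lerBlDl => /le_trans; apply.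
rewrite lerD2r (bigD1 n)//= lerDl sumr_ge0// => i _; exact: v_ge0.
Qed.

(** Otherwise some sequence in [K] has growth factors at full investment tending to infinity, yet a
    subsequence converges and these factors are bounded near its limit. *)
Lemma relatively_compact_v_bounded K : relatively_compact r K -> v_bounded K.
Proof.
move=> cK; apply: contrapT => /forallNP nb.
have /choice[Qs HQs] : forall m : nat, exists Q, K Q /\ exists n, m%:R < v r Q n (one01 R).
  move=> m; have /existsNP[Q /existsNP[n /not_implyP[KQ /negP]]] := nb m%:R.
  by rewrite -ltNge => ?; exists Q; split => //; exists n.
have [phi [Q [phi_incr cvgQ]]] := cK Qs (fun m => (HQs m).1).
have phi_ge k : (k <= phi k)%N.
  by elim: k => // k IH; rewrite (leq_ltn_trans IH)// phi_incr.
have /fine_cvgP[fin /cvgr0Pnorm_lt/(_ _ ltr01) small] := cvgQ.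
pose B := \sum_n v r Q n (one01 R) + 2 * 1.
suff : \forall k \near \oo, False by move=> /filter_ex[].
near=> k.
have [_ [n]] := HQs (phi k); apply/negP; rewrite -leNgt.
have dlt : (dist r (Qs (phi k)) Q < 1%:E)%E.
  rewrite -[X in (X < _)%E]fineK; last by near: k.
  by rewrite lte_fin (le_lt_trans (ler_norm _))//; near: k.
have := v_dist_lt halpha hr n (one01 R) dlt.
move=> /(le_trans (ler_norm _)); rewrite lerBlDl => /le_trans; apply.
apply: (@le_trans _ _ B).
  rewrite lerD2r (bigD1 n)//= lerDl sumr_ge0// => i _; exact: v_ge0.
rewrite (@le_trans _ _ k%:R)// ?ler_nat//.
by near: k; exact: nbhs_infty_ger.
Unshelve. all: by end_near. Qed.

(** A representative [Q] of the difference is chosen, and the hypothesis makes the value independent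
    of the choice; the value 0 elsewhere is a convention. *)
Lemma diff_ker_factor P (f : Ppsi alpha N -> R) :
  (forall Q Q', diff_ker r Q P = diff_ker r Q' P -> f Q = f Q') ->
  exists dV : ('I_N -> R * R -> set R -> R) -> R,
    forall Q, dV (diff_ker r Q P) = f Q.
Proof.
move=> hf; exists (fun delta =>
  if pselect (exists Q, diff_ker r Q P = delta) is left h
  then f (projT1 (cid h)) else 0) => Q.
case: pselect => [h|[]]; last by exists Q.
by apply: hf; exact: (projT2 (cid h)).
Qed.

Lemma vdot_dist_continuous P (gamma : 'I_N -> {i01 R}) (c : R) :
  dist_continuous r (fun Q => vdot r P Q gamma * c).
Proof.
move=> Q e e0.
pose B := \sum_(k < N) `|\prod_(j < N | j != k) v r P j (gamma j)|.
have B0 : 0 <= B by apply: sumr_ge0.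
have c0 : 0 < 1 + `|c| by rewrite ltr_pwDl.
have B1 : 0 < 1 + B by rewrite ltr_pwDl.
(* The final 2 offsets the Lipschitz constant of the growth factors; the added ones keep the
   denominators positive. *)
exists (e / (1 + `|c|) / (1 + B) / 2); first by rewrite !divr_gt0.
move=> Q' dQ; rewrite -mulrBl normrM.
have H : `|vdot r P Q' gamma - vdot r P Q gamma| <= e / (1 + `|c|) / (1 + B) * B.
  rewrite /vdot -sumrB (le_trans (ler_norm_sum _ _ _))// /B mulr_sumr ler_sum// => k _.
  rewrite -mulrBl normrM ler_wpM2r// opprB addrA subrK.
  by rewrite (le_trans (v_dist_lt halpha hr k (gamma k) dQ))// mulrC divfK.
apply: (@le_lt_trans _ _ (e / (1 + `|c|) * `|c|)).
  rewrite ler_wpM2r// (le_trans H)// mulrAC ler_pdivrMr//.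
  by rewrite ler_wpM2l ?ltrDr ?lerDr// divr_ge0// ltW.
by rewrite mulrAC ltr_pdivrMr// ltr_pM2l// ltrDr.
Qed.

(** Common core of both assertions: [M] is the factor at a fixed fraction for (i) and the maximal
    factor for (ii). The threshold [t0] is chosen from [C] before [Q], which gives uniformity over
    [K]. *)
Lemma differentiable_along_prod (S : set (set (Ppsi alpha N))) P
    (gamma : 'I_N -> {i01 R}) (c : R) (M : Ppsi alpha N -> 'I_N -> R)
    (V : Ppsi alpha N -> R) :
  (forall K, S K -> v_bounded K) ->
  (forall Q, V Q = \prod_(n < N) M Q n * c) ->
  (forall n, M P n = v r P n (gamma n)) ->
  (forall n (C e : R), 0 < e ->
    exists2 t0, 0 < t0 & forall (t : {i01 R}) Q, 0 < t%:num < t0 ->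
    v r Q n (one01 R) <= C ->
    `|(M (mix t P Q) n - M P n) / t%:num -
      (v r Q n (gamma n) - v r P n (gamma n))| < e) ->
  exists dV : ('I_N -> R * R -> set R -> R) -> R,
    (forall Q, dV (diff_ker r Q P) = vdot r P Q gamma * c) /\
    differentiable_along r S V P dV.
Proof.
move=> SK VE MP quot.
have [dV dVE] : exists dV : ('I_N -> R * R -> set R -> R) -> R,
    forall Q, dV (diff_ker r Q P) = vdot r P Q gamma * c.
  apply: diff_ker_factor => Q Q' QQ'; congr (_ * _).
  by apply: eq_bigr => k _; rewrite (v_diff_ker _ _ QQ').
exists dV; split => //; split.
  rewrite (_ : (fun Q => _) = fun Q => vdot r P Q gamma * c).
    exact: vdot_dist_continuous.
  exact/funext.
move=> K /SK[C KC] eps eps_gt0 eps_cvg e e0.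
have c0 : 0 < 1 + `|c| by rewrite ltr_pwDl.
have ec : 0 < e / (1 + `|c|) by rewrite divr_gt0.
have Dbound Q i : K Q -> `|v r Q i (gamma i) - v r P i (gamma i)| <=
    C + \sum_n v r P n (one01 R) + 4.
  move=> KQ; have P1 : v r P i (one01 R) <= \sum_n v r P n (one01 R).
    rewrite (bigD1 i)//= lerDl sumr_ge0// => j _; exact: v_ge0.
  apply: (@le_trans _ _ (C + v r P i (one01 R) + 4)); last by rewrite lerD2r lerD2l.
  by apply: (norm_diff_le _ _ _ _ _ (KC Q i KQ));
    [exact: v_ge0|exact: v_le_v1|exact: v_ge0|exact: v_le_v1|exact: v_ge0].
have := @prod_difference_quotient R 'I_N (Ppsi alpha N) K (M P)
  (fun m Q => M (mix (eps m) P Q))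
  (fun Q i => v r Q i (gamma i) - v r P i (gamma i)) _
  (fun m => (eps m)%:num) Dbound.
have eps01 m : 0 < (eps m)%:num <= 1 by rewrite eps_gt0/=.
move=> /(_ eps01 eps_cvg) PDQ.
have {}PDQ := PDQ _ _ ec.
have : \forall m \near \oo, forall Q, K Q ->
  `|(\prod_i M (mix (eps m) P Q) i - \prod_i M P i) / (eps m)%:num -
    \sum_k (v r Q k (gamma k) - v r P k (gamma k)) * \prod_(j | j != k) M P j| <
  e / (1 + `|c|).
  apply: PDQ => i e' e'0.
  have [t0 t00 Ht] := quot i C e' e'0.
  have /cvgr0Pnorm_lt/(_ _ t00) := eps_cvg; apply: filterS => m em Q KQ.
  apply: Ht; last exact: KC.
  by rewrite eps_gt0 (le_lt_trans (ler_norm _)).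
apply: filterS => m Hm Q KQ.
rewrite dVE !VE -mulrBl mulrAC -mulrBl normrM.
apply: (@le_lt_trans _ _ (e / (1 + `|c|) * `|c|)).
  rewrite ler_wpM2r//; apply/ltW; have := Hm Q KQ; congr (_ < _).
  congr (`|_ - _|); apply: eq_bigr => k _; congr (_ * _).
  by apply: eq_bigr => j _; rewrite MP.
by rewrite mulrAC ltr_pdivrMr// ltr_pM2l// ltrDr.
Qed.

End differentiability.

Theorem theorem4p6 (R : realType) (alpha : R) (N : nat) (r : 'I_N -> R)
    (P : Ppsi alpha N) (gamma : 'I_N -> {i01 R}) (x0 : R)
    (halpha : 0 < alpha < 1) (hr : forall n, 1 <= r n) (hP : FM r P)
    (hx0 : 0 <= x0) :
  (exists dV : ('I_N -> R * R -> set R -> R) -> R,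
    (forall Q, dV (diff_ker r Q P) = vdot r P Q gamma * u alpha x0) /\
    Frechet_differentiable r
      (fun Q => fine (policy_value r x0 (lin gamma) Q)) P dV) /\
  (exists dV : ('I_N -> R * R -> set R -> R) -> R,
    (forall Q,
      (dV (diff_ker r Q P))%:E =
        ereal_sup [set (vdot r P Q g * u alpha x0)%:E |
          g in [set g | optimal r P (lin g)]] /\
      dV (diff_ker r Q P) = vdot r P Q (gamma_opt r P) * u alpha x0) /\
    Hadamard_differentiable r (fun Q => fine (value r x0 Q)) P dV).
Proof.
split.
  apply: (differentiable_along_prod halpha hr (M := fun Q n => v r Q n (gamma n))).
  - exact: bounded_family_v_bounded.
  - by move=> Q; rewrite policy_value_lin.
  - by [].
  (* The factor is affine in [t], so the quotient is exact and any threshold serves. *)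
  move=> n C e e0; exists 1 => // t Q /andP[t0 _] _.
  by rewrite v_mix// addrAC subrr add0r mulrC mulKf ?gt_eqF// subrr normr0.
have [||||dV [dVE dVd]] := @differentiable_along_prod _ _ _ _ halpha hr
  (relatively_compact r) P (gamma_opt r P) (u alpha x0) (vmax r)
  (fun Q => fine (value r x0 Q)).
- exact: relatively_compact_v_bounded.
- by move=> Q; rewrite valueE.
- by [].
- by move=> n C e e0; exact: vmax_difference_quotient.
exists dV; split => // Q; split => //; rewrite dVE.
(* By uniqueness of the optimal linear strategy the supremum is over a single point. *)
rewrite (_ : [set g | optimal r P (lin g)] = [set gamma_opt r P]).
  by rewrite image_set1 ereal_sup1.
by apply/seteqP; split => g /=; rewrite optimal_lin.
Qed.
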